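(* For every integer $n\ge 8$, $ar(K_n,2P_4)=\max\{2n-2,16\}$.
   Context: $P_4$ is the path on $4$ vertices and $2P_4$ is the disjoint union of two copies of $P_4$. A subgraph of an edge-colored graph is rainbow if all its edges receive distinct colors. For a graph $G$, $ar(K_n,G)$ is the maximum number of colors in an edge-coloring of $K_n$ containing no rainbow copy of $G$. *)

(* Defs.v *)
From mathcomp Require Import all_boot.

Set Implicit Arguments.
Unset Strict Implicit.
Unset Printing Implicit Defensive.

Record sgraph := SGraph {
  vertex :> finType;
  adj : rel vertex;
  adj_sym : symmetric adj;
  adj_irrefl : irreflexive adj }.

Definition edges (G : sgraph) : {set {set G}} :=
  [set [set p.1; p.2] | p in [pred p : G * G | adj p.1 p.2]].

Definition complete_adj n : rel 'I_n := fun i j => i != j.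

Lemma complete_adj_sym n : symmetric (@complete_adj n).
Proof. by move=> i j; rewrite /complete_adj eq_sym. Qed.

Lemma complete_adj_irrefl n : irreflexive (@complete_adj n).
Proof. by move=> i; rewrite /complete_adj eqxx. Qed.

Definition complete n : sgraph :=
  SGraph (@complete_adj_sym n) (@complete_adj_irrefl n).

Definition path_adj n : rel 'I_n := fun i j => (i.+1 == j) || (j.+1 == i).

Lemma path_adj_sym n : symmetric (@path_adj n).
Proof. by move=> i j; rewrite /path_adj orbC. Qed.

Lemma path_adj_irrefl n : irreflexive (@path_adj n).
Proof. by move=> i; rewrite /path_adj orbb -[X in _ == X]add0n -add1n eqn_add2r. Qed.

(* [path_graph n] has n vertices, hence n - 1 edges. *)
Definition path_graph n : sgraph :=
  SGraph (@path_adj_sym n) (@path_adj_irrefl n).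

Definition disjoint_union_adj (G H : sgraph) : rel (G + H)%type :=
  fun u v => match u, v with
             | inl x, inl y => adj x y
             | inr x, inr y => adj x y
             | _, _ => false
             end.

Lemma disjoint_union_adj_sym G H : symmetric (@disjoint_union_adj G H).
Proof. by move=> [x|x] [y|y] //=; rewrite adj_sym. Qed.

Lemma disjoint_union_adj_irrefl G H : irreflexive (@disjoint_union_adj G H).
Proof. by move=> [x|x] /=; rewrite adj_irrefl. Qed.

Definition disjoint_union (G H : sgraph) : sgraph :=
  SGraph (@disjoint_union_adj_sym G H) (@disjoint_union_adj_irrefl G H).

Section EdgeColoring.

Variables (G : sgraph) (C : eqType).

(* An edge-coloring of G is given by a function on all vertex sets, of which
   only the values on [edges G] are ever used. *)
Implicit Type c : {set G} -> C.

Definition num_colors c : nat := size (undup [seq c e | e <- enum (edges G)]).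

(* The copies of H in G are the images of the embeddings f of H in G, not
   necessarily induced. *)
Definition has_rainbow_copy c (H : sgraph) : bool :=
  [exists f : {ffun H -> G},
    [&& injectiveb f,
        [forall x, forall y, adj x y ==> adj (f x) (f y)]
      & dinjectiveb (fun e : {set H} => c (f @: e)) (edges H)]].

End EdgeColoring.

(* A coloring uses at most #|edges G| colors, so a finite palette of that size
   suffices, see [leq_ar] and [ar_attained]; the extra color only keeps the
   palette inhabited when G has no edge. *)
Definition ar (G H : sgraph) : nat :=
  \max_(c : {ffun {set G} -> 'I_#|edges G|.+1} | ~~ has_rainbow_copy c H)
     num_colors c.

Lemma mem_edges_imset (G H : sgraph) (f : {ffun H -> G}) (e : {set H}) :
  [forall x, forall y, adj x y ==> adj (f x) (f y)] ->
  e \in edges H -> f @: e \in edges G.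
Proof.
move=> /'forall_forallP fh /imsetP[[x y] /= xy ->].
apply/imsetP; exists (f x, f y); last by rewrite imsetU1 imset_set1.
by have /implyP := fh x y; apply.
Qed.

Lemma leq_ar (G H : sgraph) (C : eqType) (c : {set G} -> C) :
  ~~ has_rainbow_copy c H -> num_colors c <= ar G H.
Proof.
set s := undup [seq c e | e <- enum (edges G)] => nr.
have sz : size s <= #|edges G|.
  by rewrite (leq_trans (size_undup _)) // size_map -cardE.
have cs e : e \in edges G -> c e \in s.
  by move=> eG; rewrite mem_undup map_f // mem_enum.
pose d := [ffun e : {set G} => inord (index (c e) s) : 'I_#|edges G|.+1].
have dE e : e \in edges G -> d e = index (c e) s :> nat.
  move=> eG; rewrite ffunE inordK // ltnS.
  by rewrite (leq_trans _ sz) // ltnW // index_mem cs.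
have dc e e' : e \in edges G -> e' \in edges G -> d e = d e' -> c e = c e'.
  move=> eG e'G /(congr1 val) /=; rewrite !dE // => /(congr1 (nth (c e) s)).
  by rewrite !nth_index ?cs.
have nrd : ~~ has_rainbow_copy d H.
  apply: contra nr => /existsP[f /and3P[fi fh /dinjectiveP fr]].
  apply/existsP; exists f; rewrite fi fh /=; apply/dinjectiveP => e e' eH e'H ce.
  by apply: fr => //; rewrite !ffunE ce.
apply: leq_trans (leq_bigmax_cond d nrd).
rewrite /num_colors -/s -(size_map (fun x => inord (index x s) : 'I_#|edges G|.+1)).
apply: uniq_leq_size.
  rewrite map_inj_in_uniq ?undup_uniq // => x y.
  rewrite !mem_undup => /mapP[e]; rewrite mem_enum => eG ->.
  move=> /mapP[e']; rewrite mem_enum => e'G -> ee'.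
  by apply: dc => //; rewrite !ffunE.
move=> _ /mapP[x xs ->]; move: xs; rewrite !mem_undup => /mapP[e eG ->].
by apply/mapP; exists e => //; rewrite ffunE.
Qed.

Lemma ar_attained (G H : sgraph) (C : eqType) (c0 : {set G} -> C) :
  ~~ has_rainbow_copy c0 H ->
  exists c : {set G} -> nat, ~~ has_rainbow_copy c H /\ num_colors c = ar G H.
Proof.
move=> nr0; have le0 := leq_ar nr0.
have : exists c : {ffun {set G} -> 'I_#|edges G|.+1},
    ~~ has_rainbow_copy c H /\ num_colors c = ar G H.
  case: (pickP (fun c : {ffun {set G} -> 'I_#|edges G|.+1} =>
                  ~~ has_rainbow_copy c H)) => [c nc|no].
    rewrite /ar (bigmax_eq_arg c) //; case: arg_maxnP => // d nd _.
    by exists d.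
  have ar0 : ar G H = 0 by rewrite /ar big_pred0.
  case: (posnP #|edges G|) => [E0|Epos].
    have ncol (D : eqType) (c : {set G} -> D) : num_colors c = 0.
      by rewrite /num_colors (cards0_eq E0) enum_set0.
    exists [ffun=> ord0]; rewrite ncol ar0; split=> //.
    apply: contra nr0 => /existsP[f /and3P[fi fh _]]; apply/existsP; exists f.
    rewrite fi fh /=; apply/dinjectiveP => e e' eH.
    by have := mem_edges_imset fh eH; rewrite (cards0_eq E0) inE.
  have /card_gt0P[e eG] := Epos.
  have : c0 e \in undup [seq c0 e | e <- enum (edges G)].
    by rewrite mem_undup map_f // mem_enum.
  by move: le0; rewrite ar0 leqn0 size_eq0 => /eqP->.
case=> c [nc <-]; exists (fun e => c e : nat); split.
  apply: contra nc => /existsP[f /and3P[fi fh /dinjectiveP fr]].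
  apply/existsP; exists f; rewrite fi fh /=; apply/dinjectiveP => e e' eH e'H ce.
  by apply: fr => //; rewrite /= ce.
by rewrite /num_colors (map_comp val c) (undup_map_inj val_inj) size_map.
Qed.

(* Main.v *)
Require Import Defs.
From mathcomp Require Import all_boot zify.

Set Implicit Arguments.
Unset Strict Implicit.
Unset Printing Implicit Defensive.

(** The lower bounds come from giving distinct colors to the edges meeting two
    fixed vertices, respectively to the edges inside six fixed vertices, and one
    further color to all the other edges: two disjoint P4 contain two edges of
    the last kind.

    For the upper bound, call a color saturated at v when all its edges contain
    v. A vertex with at most two saturated colors can be deleted, by induction.
    Otherwise one edge for each vertex and color saturated at it yields a
    rainbow graph of minimum degree 3, which contains two disjoint P4, or a path
    on 7 vertices, or is spanned by a cycle on at most 6 vertices. On at least 8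
    vertices the path is the only option left, and an outside vertex w then
    forces the colors of the edges from w to the odd vertices of the path, which
    is incompatible with the degree of an endpoint. On 8 or 9 vertices, deleting
    vertices with at most two saturated colors still leaves a rainbow path on 7
    vertices, 6-cycle or wheel with four spokes, and a short case analysis, given
    by certificates that are checked by computation, shows that the coloring
    has at most 16 colors. *)

(** * Certificates bounding the number of colors *)

Definition edge := (nat * nat)%type.

(** The smaller end comes first, so that equal edges are equal pairs. *)
Definition mk_edge (i j : nat) : edge := if i < j then (i, j) else (j, i).

(** The reversal makes the [foldr] in [blocks] insert the edges in lexicographic order. *)
Definition all_edges m : seq edge :=
  rev [seq p <- [seq (i, j) | i <- iota 0 m, j <- iota 0 m] | p.1 < p.2].

Definition two_paths (v : seq nat) : seq edge :=
  let e i := mk_edge (nth 0 v i) (nth 0 v i.+1) in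
  [:: e 0; e 1; e 2; e 4; e 5; e 6].

(* [(es, ks)] states that the colors of the edges in [es] and the colors
   numbered by [ks] are not all distinct. *)
Definition clause := (seq edge * seq nat)%type.

(** A clause in which color [i] would occur twice is satisfied and dropped. In the other clauses
    that contain [e], it is replaced by its color. *)
Definition assign (e : edge) (i : nat) (cs : seq clause) : seq clause :=
  pmap (fun q : clause =>
    if e \in q.1 then
      if i \in q.2 then None else Some (rem e q.1, i :: q.2)
    else Some q) cs.

(** A clause with just two edges left says that they share a color or that one of them has a
    numbered color: together they bring at most one new color. *)
Definition clashing (cs : seq clause) (e : edge) : seq edge :=
  flatten [seq if q.1 is [:: f; g] then
                 if f == e then [:: g] else if g == e then [:: f] else [::]
               else [::] | q <- cs].

(** One step of a greedy clique cover of the clash graph, where [fs] lists the edges that clash with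
    [e]. *)
Fixpoint insert (fs : seq edge) e (bs : seq (seq edge)) :=
  if bs is b :: bs' then
    if all (mem fs) b then (e :: b) :: bs' else b :: insert fs e bs'
  else [:: [:: e]].

(** An edge that is alone in a clause must repeat a numbered color, hence is left out of the
    count. *)
Definition blocks (us : seq edge) (cs : seq clause) :=
  foldr (fun e => insert (clashing cs e) e) [::]
    [seq e <- us | ~~ has (fun q : clause => q.1 == [:: e]) cs].

(* In each block of pairwise clashing edges at most one color is new. *)
Definition closed (b k : nat) us cs :=
  has (fun q : clause => q.1 == [::]) cs || (k + size (blocks us cs) <= b).

Inductive tree := Leaf | Node of nat & nat & seq tree.

(* The i-th subtree of [Node x y ts] deals with the case that the edge xy has
   the i-th color, the last one with the case that its color is new. *)
Fixpoint refutes b (t : tree) k us cs {struct t} : bool :=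
  if t is Node x y ts then
    (fix branch ts i := if ts is t' :: ts' then
         refutes b t' (maxn k i.+1) [seq f <- us | f != (x, y)]
           (assign (x, y) i cs)
         && branch ts' i.+1
       else i == k.+1) ts 0
  else closed b k us cs.

Fixpoint refutes_from b t st k us cs :=
  if st is e :: st' then
    refutes_from b t st' k.+1 [seq f <- us | f != e] (assign e k cs)
  else refutes b t k us cs.

Definition certified m b (st : seq edge) (paths : seq (seq nat)) t :=
  all (fun v => [&& size v == 8, uniq v & all (gtn m) v]) paths &&
  refutes_from b t st 0 (all_edges m) [seq (two_paths v, [::]) | v <- paths].

(** * Soundness of the certificate checker *)

Section Soundness.

Variables (C : eqType) (col : edge -> C) (d : C).
Implicit Types (K : seq C) (us : seq edge) (cs : seq clause) (q : clause).

(** Clauses name colors by their position in the list [K] of known colors, so the checker computes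
    without knowing [C]. *)
Definition valid K q :=
  [&& uniq q.2, all (gtn (size K)) q.2
    & ~~ uniq (map col q.1 ++ map (nth d K) q.2)].

Lemma uniq_valid K q : uniq K -> valid K q -> uniq (map (nth d K) q.2).
Proof.
move=> uK /and3P[uq /allP aq _]; rewrite map_inj_in_uniq // => i j iq jq /eqP.
by rewrite nth_uniq; [move/eqP | exact: (aq i) | exact: (aq j) |].
Qed.

Lemma valid_rcons K c q : valid K q -> valid (rcons K c) q.
Proof.
case/and3P=> uq /allP aq nq; apply/and3P; split=> //.
  by apply/allP=> i /aq /= iK; rewrite /= size_rcons ltnS ltnW.
have -> // : map (nth d (rcons K c)) q.2 = map (nth d K) q.2.
by apply/eq_in_map => i /aq /= iK; rewrite nth_rcons iK.
Qed.

Lemma valid_assign K cs e i : i < size K -> nth d K i = col e ->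
  all (valid K) cs -> all (valid K) (assign e i cs).
Proof.
move=> iK Ki /allP vcs; apply/allP=> q'; rewrite mem_pmap => /mapP[q /vcs vq].
case: ifP => [eq|_ [->] //]; case: ifP => // /negbT niq [->].
case/and3P: vq => uq aq nq; apply/and3P; split=> /=; rewrite ?niq ?iK //.
set xs := map col (rem e q.1); set ys := map (nth d K) q.2.
apply: contra nq => u; rewrite (perm_uniq (s2 := col e :: xs ++ ys)).
  by rewrite -Ki (perm_uniq (s2 := xs ++ nth d K i :: ys)) // -cat1s perm_catCA.
by rewrite -cat_cons perm_cat2r -map_cons perm_map // perm_to_rem.
Qed.

(** The numbered colors of a clause are distinct because [K] is duplicate-free, so the repetition
    involves one of the two remaining edges. *)
Lemma clashing_new K cs e f : uniq K -> all (valid K) cs ->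
  f \in clashing cs e -> [|| col e \in K, col f \in K | col f == col e].
Proof.
move=> uK /allP vcs /flatten_mapP[q /vcs vq].
have uq := uniq_valid uK vq; case/and3P: vq => _ /allP aq.
have mK c : c \in map (nth d K) q.2 -> c \in K.
  by case/mapP=> i /aq iK ->; apply: mem_nth.
case: q.1 => [|g [|h [|]]] //=. rewrite in_cons uq andbT negb_and !negbK => nq.
have {nq} H : [|| col g \in K, col h \in K | col g == col h].
  by case/orP: nq => [/orP[->|/mK ->]|/mK ->]; rewrite ?orbT.
case: eqVneq => [<-|_]; first by rewrite inE => /eqP ->; rewrite [col h == _]eq_sym.
by case: eqVneq => [<-|//]; rewrite inE => /eqP ->; rewrite orbCA.
Qed.

Lemma single_old K q e : uniq K -> valid K q -> q.1 = [:: e] -> col e \in K.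
Proof.
move=> uK vq q1; have uq := uniq_valid uK vq; case/and3P: vq => _ /allP aq.
rewrite q1 /= uq andbT negbK => /mapP[i /aq iK ->]; exact: mem_nth.
Qed.

Lemma insert_pairwise (r : rel edge) fs e bs : (forall f, f \in fs -> r e f) ->
  all (pairwise r) bs -> all (pairwise r) (insert fs e bs).
Proof.
move=> rfs; elim: bs => //= b bs IH /andP[pb pbs].
case: ifP => /= [/allP bfs|_]; rewrite pb /= ?IH // pbs !andbT.
by apply/allP=> f /bfs /rfs.
Qed.

Lemma mem_insert fs e bs : flatten (insert fs e bs) =i e :: flatten bs.
Proof.
elim: bs => //= b bs IH f; case: ifP => //= _.
by rewrite mem_cat IH !inE mem_cat orbCA.
Qed.

(** Each block contributes one color to [L]: once an edge of the block has a color outside [K], the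
    edges clashing with it have that color or one in [K]. *)
Lemma blocks_new K cs (bs : seq (seq edge)) : uniq K -> all (valid K) cs ->
  all (pairwise (fun e f => f \in clashing cs e)) bs ->
  exists2 L : seq C, size L <= size bs
    & forall e, e \in flatten bs -> col e \in K ++ L.
Proof.
move=> uK vcs; elim: bs => [_|b bs IH /= /andP[pb /IH[L sL mL]]].
  by exists [::].
have [c mc] : exists c, forall e, e \in b -> (col e \in K) || (col e == c).
  elim: b pb => [|e b IHb] /=; first by exists d.
  case/andP=> /allP ae /IHb[c mc]; case: (boolP (col e \in K)) => [eK|neK].
    by exists c => f; rewrite inE => /predU1P[->|/mc //]; rewrite eK.
  exists (col e) => f; rewrite inE => /predU1P[->|/ae fe].
    by rewrite eqxx orbT.
  by have := clashing_new uK vcs fe; rewrite (negPf neK).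
exists (c :: L) => // e; rewrite /= !mem_cat => /orP[/mc|/mL].
  by rewrite inE; case/orP=> ->; rewrite ?orbT.
by rewrite mem_cat inE => /orP[] ->; rewrite ?orbT.
Qed.

Lemma closed_sound b K us cs (es : seq edge) :
  closed b (size K) us cs -> uniq K -> all (valid K) cs ->
  {in es, forall e, (e \in us) || (col e \in K)} ->
  size (undup (map col es)) <= b.
Proof.
move=> cl uK vcs cov; case/orP: cl => [/hasP[q qcs /eqP q1]|le_b].
  (* A clause without edges claims a repetition among distinct known colors, which is absurd. *)
  have := allP vcs _ qcs; have := uniq_valid uK (allP vcs _ qcs).
  by rewrite /valid q1 /= => ->; rewrite !andbF.
have pw : all (pairwise (fun e f => f \in clashing cs e)) (blocks us cs).
  rewrite /blocks; elim: [seq _ <- us | _] => //= e s IH.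
  exact: insert_pairwise.
have mb : flatten (blocks us cs)
    =i [seq e <- us | ~~ has (fun q : clause => q.1 == [:: e]) cs].
  rewrite /blocks; elim: [seq _ <- us | _] => //= e s IH f.
  by rewrite mem_insert !inE IH.
have [L sL mL] := blocks_new uK vcs pw.
apply: leq_trans (_ : size (K ++ L) <= b); last first.
  by rewrite size_cat (leq_trans _ le_b) // leq_add2l.
apply: uniq_leq_size; first exact: undup_uniq.
move=> c; rewrite mem_undup => /mapP[e ees ->].
case/orP: (cov e ees) => [eus|eK]; last by rewrite mem_cat eK.
case: (boolP (has (fun q : clause => q.1 == [:: e]) cs)) => [|ns].
  case/hasP=> q qcs /eqP q1.
  by rewrite mem_cat (single_old uK (allP vcs _ qcs) q1).
by apply: mL; rewrite mb mem_filter ns.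
Qed.

(** Invariant along a branch: [K] lists distinct known colors, the clauses hold, and every edge is
    undecided or colored from [K]. Two nested [fix] follow the nesting of [tree] in [seq]. *)
Lemma refutes_sound b t K us cs (es : seq edge) :
  refutes b t (size K) us cs -> uniq K -> all (valid K) cs ->
  {in es, forall e, (e \in us) || (col e \in K)} ->
  size (undup (map col es)) <= b.
Proof.
move: t K us cs; fix IH 1 => -[|x y ts] K us cs; first exact: closed_sound.
move=> br uK vcs cov; set e := (x, y).
(* The subtree to follow has the index of the color of [e] in [K]; this index is [size K] exactly
   when the color is new. *)
have [i iK ei] : exists2 i, i <= size K & index (col e) K = i.
  by exists (index (col e) K) => //; apply: index_size.
suff: forall i0, i0 <= i ->
    (fix branch (ts : seq tree) i := if ts is t' :: ts' then
         refutes b t' (maxn (size K) i.+1) [seq f <- us | f != (x, y)]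
           (assign (x, y) i cs)
         && branch ts' i.+1
       else i == (size K).+1) ts i0 -> size (undup (map col es)) <= b.
  by move/(_ 0); apply.
move: ts {br}; fix IHts 1 => -[|t ts] i0 i0i.
  by move/eqP=> i0K; move: i0i; rewrite i0K ltnNge iK.
case/andP=> rt; case: (eqVneq i0 i) => [i0E _|ne]; last first.
  by apply: IHts; rewrite ltn_neqAle ne.
have cov' K' : col e \in K' -> {subset K <= K'} ->
    {in es, forall f, (f \in [seq f <- us | f != e]) || (col f \in K')}.
  move=> eK' KK' f /cov; rewrite mem_filter.
  by case: eqVneq => [->|_] /=; rewrite ?eK' // => /orP[->//|/KK' ->]; rewrite orbT.
move: iK; rewrite leq_eqVlt => /predU1P[iK|iK].
  have neK : col e \notin K by rewrite -index_mem ei iK ltnn.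
  apply: (IH t (rcons K (col e)) [seq f <- us | f != e] (assign e i cs)).
  - by move: rt; rewrite size_rcons i0E iK (maxn_idPr (leqnSn _)).
  - by rewrite rcons_uniq neK.
  - apply: valid_assign; first by rewrite size_rcons iK.
      by rewrite nth_rcons iK ltnn eqxx.
    by apply: sub_all vcs => q; apply: valid_rcons.
  - apply: cov' => [|c cK]; first by rewrite mem_rcons mem_head.
    by rewrite mem_rcons inE cK orbT.
have eK : col e \in K by rewrite -index_mem ei.
apply: (IH t K [seq f <- us | f != e] (assign e i cs)) => //; last exact: cov'.
  by move: rt; rewrite i0E (maxn_idPl iK).
by apply: valid_assign => //; rewrite -ei nth_index.
Qed.

(** The starting edges have pairwise distinct colors, so each takes the next free number and no
    branching occurs. *)
Lemma refutes_from_sound b t st K us cs (es : seq edge) :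
  refutes_from b t st (size K) us cs ->
  uniq (K ++ map col st) -> all (valid K) cs ->
  {in es, forall e, (e \in us) || (col e \in K)} ->
  size (undup (map col es)) <= b.
Proof.
elim: st K us cs => [|e st IH] K us cs /=.
  by rewrite cats0; apply: refutes_sound.
rewrite -cat_rcons -(size_rcons K (col e)) => rf u vcs cov.
apply: IH rf u _ _.
  apply: valid_assign; first by rewrite size_rcons.
    by rewrite nth_rcons ltnn eqxx.
  by apply: sub_all vcs => q; apply: valid_rcons.
move=> f /cov; rewrite mem_filter mem_rcons inE.
by case: eqVneq => [->|_] /=; rewrite ?eqxx ?orbT // => /orP[->//|->]; rewrite !orbT.
Qed.

Lemma certified_sound m b st paths t :
  certified m b st paths t ->
  (forall v, size v = 8 -> uniq v -> all (gtn m) v ->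
     ~~ uniq (map col (two_paths v))) ->
  uniq (map col st) ->
  size (undup (map col (all_edges m))) <= b.
Proof.
case/andP=> /allP okp rf nr ust; apply: (refutes_from_sound (K := [::]) rf) => //.
  apply/allP=> _ /mapP[v /okp /and3P[/eqP sv uv av] ->].
  exact: nr.
by move=> e ->.
Qed.

End Soundness.

(* The lists of paths and the trees were found by a computer search. *)
Lemma cycle6_8_certified : certified 8 16
  [:: (0, 1); (1, 2); (2, 3); (3, 4); (4, 5); (0, 5)]
  [:: [:: 0; 1; 2; 3; 4; 5; 6; 7]; [:: 0; 1; 2; 3; 5; 4; 7; 6]; [:: 0; 1; 4; 5;
  2; 3; 7; 6]; [:: 0; 1; 6; 7; 2; 3; 4; 5]; [:: 0; 1; 7; 6; 3; 2; 5; 4]; [:: 0;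
  3; 4; 5; 1; 2; 6; 7]; [:: 0; 5; 4; 1; 2; 3; 7; 6]; [:: 0; 5; 4; 3; 2; 1; 7;
  6]; [:: 0; 5; 4; 3; 6; 1; 2; 7]; [:: 0; 5; 4; 7; 1; 2; 3; 6]; [:: 0; 5; 6; 7;
  1; 2; 3; 4]; [:: 0; 5; 7; 6; 2; 1; 3; 4]; [:: 1; 0; 2; 3; 4; 5; 7; 6]; [:: 1;
  0; 2; 3; 5; 4; 6; 7]; [:: 1; 0; 3; 2; 5; 4; 7; 6]; [:: 1; 0; 4; 5; 2; 3; 6;
  7]; [:: 1; 0; 5; 4; 3; 2; 6; 7]; [:: 1; 0; 5; 4; 3; 2; 7; 6]; [:: 1; 0; 5; 7;
  2; 3; 4; 6]; [:: 1; 0; 6; 7; 2; 3; 4; 5]; [:: 1; 0; 7; 6; 3; 2; 4; 5]; [:: 1;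
  2; 0; 5; 3; 4; 7; 6]; [:: 1; 2; 0; 5; 4; 3; 6; 7]; [:: 2; 1; 0; 5; 3; 4; 6;
  7]; [:: 2; 1; 0; 5; 4; 3; 7; 6]; [:: 2; 1; 0; 6; 3; 4; 5; 7]; [:: 3; 0; 5; 4;
  2; 1; 6; 7]; [:: 3; 4; 0; 5; 1; 2; 6; 7]; [:: 4; 3; 0; 5; 1; 2; 7; 6]; [:: 4;
  3; 0; 5; 2; 1; 6; 7]; [:: 5; 0; 6; 7; 2; 1; 3; 4]; [:: 5; 0; 7; 6; 1; 2; 3;
  4]; [:: 5; 0; 7; 6; 2; 1; 4; 3]]
  (Node 6 7 [:: Leaf; Leaf; Leaf; Leaf; Leaf; Leaf; Leaf]).
Proof. by vm_compute. Qed.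

Lemma path7_8_certified : certified 8 16
  [:: (0, 1); (1, 2); (2, 3); (3, 4); (4, 5); (5, 6)]
  [:: [:: 0; 1; 2; 3; 4; 5; 7; 6]; [:: 0; 1; 2; 3; 6; 5; 4; 7]; [:: 0; 1; 2; 6;
  3; 4; 5; 7]; [:: 0; 1; 2; 6; 5; 4; 3; 7]; [:: 0; 1; 2; 7; 3; 4; 5; 6]; [:: 0;
  1; 5; 4; 2; 3; 7; 6]; [:: 0; 3; 4; 5; 1; 2; 6; 7]; [:: 0; 4; 5; 6; 1; 2; 3;
  7]; [:: 0; 4; 5; 6; 3; 2; 1; 7]; [:: 0; 5; 6; 7; 1; 2; 3; 4]; [:: 0; 7; 1; 2;
  3; 4; 5; 6]; [:: 0; 7; 3; 4; 1; 2; 5; 6]; [:: 0; 7; 6; 5; 1; 4; 3; 2]; [:: 1;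
  0; 3; 2; 4; 5; 6; 7]; [:: 1; 0; 6; 7; 2; 3; 4; 5]; [:: 1; 0; 7; 6; 2; 5; 4;
  3]; [:: 1; 2; 0; 7; 3; 4; 5; 6]; [:: 2; 0; 1; 7; 3; 4; 5; 6]; [:: 2; 1; 0; 6;
  3; 4; 5; 7]; [:: 2; 1; 0; 7; 3; 5; 6; 4]; [:: 2; 1; 0; 7; 3; 6; 5; 4]; [:: 2;
  1; 0; 7; 4; 3; 5; 6]; [:: 2; 1; 0; 7; 5; 3; 4; 6]; [:: 2; 1; 0; 7; 5; 4; 3;
  6]; [:: 2; 3; 0; 7; 1; 6; 5; 4]; [:: 3; 1; 0; 7; 2; 4; 5; 6]; [:: 3; 2; 0; 7;
  1; 4; 5; 6]; [:: 3; 4; 0; 7; 1; 2; 5; 6]; [:: 4; 3; 0; 7; 1; 2; 6; 5]; [:: 5;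
  1; 0; 7; 2; 3; 4; 6]; [:: 5; 1; 0; 7; 4; 3; 2; 6]; [:: 5; 6; 0; 7; 1; 2; 3;
  4]; [:: 6; 1; 0; 7; 2; 3; 4; 5]; [:: 6; 5; 0; 7; 1; 2; 3; 4]]
  (Node 0 7 [:: Leaf; Node 6 7 [:: Leaf; Leaf; Leaf; Leaf; Leaf; Leaf; Leaf];
  Leaf; Leaf; Leaf; Node 6 7 [:: Leaf; Leaf; Leaf; Leaf; Leaf; Leaf; Leaf];
  Leaf]).
Proof. by vm_compute. Qed.

Lemma path7_9_certified : certified 9 16
  [:: (0, 1); (1, 2); (2, 3); (3, 4); (4, 5); (5, 6)]
  [:: [:: 0; 1; 2; 3; 4; 5; 6; 8]; [:: 0; 1; 2; 3; 4; 5; 7; 6]; [:: 0; 1; 2; 3;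
  5; 4; 6; 7]; [:: 0; 1; 2; 3; 6; 4; 5; 7]; [:: 0; 1; 2; 3; 6; 5; 4; 7]; [:: 0;
  1; 2; 3; 6; 5; 4; 8]; [:: 0; 1; 2; 4; 3; 5; 6; 7]; [:: 0; 1; 2; 5; 4; 3; 6;
  7]; [:: 0; 1; 2; 6; 5; 4; 3; 7]; [:: 0; 1; 2; 6; 5; 4; 3; 8]; [:: 0; 1; 2; 7;
  3; 4; 5; 6]; [:: 0; 1; 2; 8; 3; 4; 5; 6]; [:: 0; 1; 3; 2; 4; 5; 6; 7]; [:: 0;
  1; 4; 3; 5; 6; 7; 8]; [:: 0; 1; 4; 5; 3; 2; 6; 7]; [:: 0; 1; 5; 4; 2; 3; 7;
  6]; [:: 0; 1; 6; 7; 4; 3; 2; 5]; [:: 0; 1; 7; 6; 2; 3; 4; 5]; [:: 0; 1; 8; 7;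
  2; 3; 4; 5]; [:: 0; 2; 3; 1; 4; 5; 6; 7]; [:: 0; 3; 4; 5; 1; 2; 6; 7]; [:: 0;
  4; 3; 2; 1; 5; 6; 7]; [:: 0; 4; 5; 6; 1; 2; 3; 7]; [:: 0; 4; 5; 6; 1; 2; 3;
  8]; [:: 0; 5; 6; 7; 1; 2; 3; 4]; [:: 0; 6; 5; 4; 3; 2; 1; 7]; [:: 0; 7; 1; 2;
  3; 4; 5; 6]; [:: 0; 7; 3; 2; 1; 6; 5; 4]; [:: 0; 7; 3; 4; 2; 1; 5; 6]; [:: 0;
  7; 6; 5; 1; 4; 3; 2]; [:: 0; 7; 6; 5; 3; 2; 1; 4]; [:: 0; 8; 1; 2; 4; 5; 6;
  7]; [:: 0; 8; 3; 4; 1; 5; 6; 7]; [:: 1; 0; 2; 3; 4; 5; 6; 7]; [:: 1; 0; 3; 2;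
  4; 5; 6; 7]; [:: 1; 0; 3; 4; 2; 5; 6; 7]; [:: 1; 0; 5; 4; 2; 3; 6; 7]; [:: 1;
  0; 6; 7; 2; 3; 4; 5]; [:: 1; 0; 7; 6; 3; 2; 4; 5]; [:: 1; 0; 7; 8; 2; 3; 4;
  5]; [:: 1; 0; 8; 5; 4; 3; 2; 6]; [:: 1; 2; 3; 4; 5; 6; 7; 8]; [:: 1; 2; 3; 4;
  7; 6; 5; 8]; [:: 1; 2; 3; 8; 4; 5; 6; 7]; [:: 2; 0; 1; 3; 4; 5; 6; 7]; [:: 2;
  0; 1; 8; 3; 4; 5; 6]; [:: 2; 0; 7; 6; 1; 3; 4; 5]; [:: 2; 1; 0; 3; 4; 5; 6;
  7]; [:: 2; 1; 0; 7; 3; 4; 5; 8]; [:: 2; 1; 0; 7; 3; 8; 5; 6]; [:: 2; 1; 0; 7;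
  4; 3; 5; 6]; [:: 2; 1; 0; 7; 5; 4; 3; 6]; [:: 2; 1; 0; 7; 5; 4; 3; 8]; [:: 2;
  1; 0; 8; 3; 4; 5; 6]; [:: 2; 1; 0; 8; 4; 5; 6; 7]; [:: 2; 1; 0; 8; 5; 4; 3;
  7]; [:: 2; 1; 8; 3; 4; 5; 6; 7]; [:: 3; 0; 7; 6; 2; 1; 4; 5]; [:: 3; 0; 7; 6;
  2; 1; 5; 4]; [:: 3; 2; 1; 8; 4; 5; 6; 7]; [:: 3; 4; 0; 8; 1; 5; 6; 7]; [:: 4;
  3; 0; 7; 2; 1; 6; 5]; [:: 5; 1; 0; 8; 4; 3; 7; 6]; [:: 5; 4; 0; 7; 1; 2; 3;
  6]; [:: 5; 6; 0; 7; 1; 2; 3; 4]; [:: 6; 0; 1; 8; 2; 3; 4; 5]; [:: 6; 1; 0; 7;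
  3; 2; 5; 4]; [:: 6; 1; 0; 8; 2; 3; 4; 5]; [:: 6; 5; 0; 7; 1; 2; 3; 4]; [:: 6;
  5; 0; 8; 1; 2; 3; 4]; [:: 7; 0; 1; 8; 2; 3; 4; 5]; [:: 7; 1; 0; 8; 2; 3; 4;
  5]]
  (Node 6 7 [:: Node 0 7 [:: Leaf; Leaf; Leaf; Leaf; Leaf; Leaf; Leaf]; Leaf;
  Node 0 8 [:: Leaf; Leaf; Leaf; Leaf; Leaf; Leaf; Leaf]; Leaf; Node 0 7 [::
  Leaf; Leaf; Leaf; Leaf; Leaf; Leaf; Leaf]; Node 0 7 [:: Leaf; Leaf; Leaf;
  Leaf; Leaf; Leaf; Leaf]; Leaf]).
Proof. by vm_compute. Qed.

Lemma cycle6_9_certified : certified 9 16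
  [:: (0, 1); (1, 2); (2, 3); (3, 4); (4, 5); (0, 5)]
  [:: [:: 0; 1; 2; 3; 4; 5; 7; 6]; [:: 0; 1; 2; 3; 4; 5; 8; 6]; [:: 0; 1; 2; 3;
  5; 4; 6; 8]; [:: 0; 1; 2; 3; 5; 4; 7; 6]; [:: 0; 1; 2; 3; 5; 4; 8; 7]; [:: 0;
  1; 2; 3; 6; 4; 5; 8]; [:: 0; 1; 2; 3; 6; 5; 4; 7]; [:: 0; 1; 2; 4; 3; 6; 7;
  8]; [:: 0; 1; 2; 5; 4; 3; 6; 7]; [:: 0; 1; 2; 5; 6; 4; 3; 8]; [:: 0; 1; 2; 7;
  5; 4; 3; 6]; [:: 0; 1; 2; 8; 5; 3; 4; 6]; [:: 0; 1; 2; 8; 5; 4; 3; 6]; [:: 0;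
  1; 3; 2; 4; 5; 6; 7]; [:: 0; 1; 4; 5; 2; 3; 7; 6]; [:: 0; 1; 4; 5; 3; 2; 6;
  7]; [:: 0; 1; 6; 7; 2; 3; 4; 5]; [:: 0; 1; 6; 7; 3; 2; 4; 5]; [:: 0; 1; 7; 6;
  2; 3; 4; 5]; [:: 0; 1; 7; 6; 3; 2; 5; 4]; [:: 0; 2; 1; 5; 3; 4; 6; 7]; [:: 0;
  3; 4; 5; 1; 2; 6; 7]; [:: 0; 5; 1; 2; 4; 3; 6; 7]; [:: 0; 5; 2; 1; 3; 4; 6;
  7]; [:: 0; 5; 2; 1; 4; 3; 7; 6]; [:: 0; 5; 3; 2; 4; 6; 7; 8]; [:: 0; 5; 3; 2;
  7; 6; 4; 8]; [:: 0; 5; 4; 3; 1; 2; 6; 7]; [:: 0; 5; 4; 3; 1; 2; 7; 6]; [:: 0;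
  5; 4; 3; 1; 2; 8; 7]; [:: 0; 5; 4; 3; 2; 1; 6; 7]; [:: 0; 5; 4; 3; 6; 1; 2;
  7]; [:: 0; 5; 4; 3; 6; 2; 1; 7]; [:: 0; 5; 4; 6; 1; 2; 3; 8]; [:: 0; 5; 4; 6;
  1; 3; 2; 8]; [:: 0; 5; 4; 6; 3; 2; 1; 8]; [:: 0; 5; 4; 7; 1; 2; 3; 6]; [:: 0;
  5; 4; 8; 1; 2; 3; 6]; [:: 0; 5; 6; 7; 2; 1; 4; 3]; [:: 0; 5; 7; 6; 1; 2; 3;
  4]; [:: 0; 5; 7; 6; 2; 1; 4; 3]; [:: 0; 8; 2; 3; 5; 4; 6; 7]; [:: 1; 0; 2; 3;
  4; 5; 6; 7]; [:: 1; 0; 2; 3; 5; 4; 6; 7]; [:: 1; 0; 2; 3; 5; 4; 7; 6]; [:: 1;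
  0; 3; 2; 4; 5; 6; 7]; [:: 1; 0; 3; 2; 5; 4; 6; 7]; [:: 1; 0; 3; 2; 5; 4; 6;
  8]; [:: 1; 0; 3; 2; 5; 4; 7; 6]; [:: 1; 0; 4; 5; 2; 3; 6; 7]; [:: 1; 0; 4; 5;
  3; 2; 7; 6]; [:: 1; 0; 5; 2; 3; 4; 6; 7]; [:: 1; 0; 5; 2; 3; 4; 7; 6]; [:: 1;
  0; 5; 2; 6; 4; 3; 8]; [:: 1; 0; 5; 4; 2; 3; 6; 8]; [:: 1; 0; 5; 4; 2; 3; 7;
  8]; [:: 1; 0; 5; 4; 2; 3; 8; 7]; [:: 1; 0; 5; 4; 3; 2; 6; 7]; [:: 1; 0; 5; 4;
  6; 3; 2; 8]; [:: 1; 0; 5; 4; 7; 6; 3; 8]; [:: 1; 0; 5; 7; 2; 3; 4; 6]; [:: 1;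
  0; 5; 8; 2; 3; 4; 6]; [:: 1; 0; 5; 8; 2; 4; 3; 6]; [:: 1; 0; 6; 7; 2; 3; 5;
  4]; [:: 1; 0; 6; 7; 4; 3; 2; 5]; [:: 1; 0; 6; 8; 2; 3; 4; 5]; [:: 1; 0; 7; 6;
  2; 3; 4; 5]; [:: 1; 0; 7; 6; 3; 2; 4; 5]; [:: 1; 2; 0; 5; 3; 4; 7; 6]; [:: 1;
  2; 0; 5; 4; 3; 6; 7]; [:: 1; 2; 4; 5; 7; 6; 3; 8]; [:: 1; 5; 0; 2; 3; 4; 6;
  7]; [:: 1; 5; 0; 6; 2; 3; 4; 8]; [:: 1; 5; 0; 8; 2; 3; 4; 6]; [:: 1; 5; 0; 8;
  3; 4; 6; 7]; [:: 2; 0; 1; 3; 5; 4; 6; 7]; [:: 2; 0; 1; 8; 5; 4; 3; 6]; [:: 2;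
  0; 5; 4; 1; 3; 6; 7]; [:: 2; 0; 6; 7; 1; 3; 4; 5]; [:: 2; 1; 0; 3; 4; 5; 6;
  7]; [:: 2; 1; 0; 3; 5; 4; 6; 7]; [:: 2; 1; 0; 5; 3; 4; 6; 7]; [:: 2; 1; 0; 5;
  3; 4; 6; 8]; [:: 2; 1; 0; 5; 3; 4; 7; 6]; [:: 2; 1; 0; 5; 4; 3; 6; 8]; [:: 2;
  1; 0; 5; 4; 3; 7; 6]; [:: 2; 1; 0; 5; 6; 3; 4; 8]; [:: 2; 1; 0; 5; 6; 4; 3;
  8]; [:: 2; 1; 0; 5; 7; 3; 4; 8]; [:: 2; 1; 0; 5; 7; 4; 3; 8]; [:: 2; 1; 0; 5;
  7; 6; 4; 8]; [:: 2; 1; 0; 6; 3; 4; 5; 7]; [:: 2; 1; 0; 6; 3; 4; 5; 8]; [:: 2;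
  1; 0; 6; 5; 3; 4; 8]; [:: 2; 1; 0; 6; 5; 4; 3; 7]; [:: 2; 1; 0; 6; 5; 4; 3;
  8]; [:: 2; 1; 0; 7; 5; 4; 3; 6]; [:: 2; 1; 0; 8; 3; 4; 6; 7]; [:: 2; 1; 0; 8;
  3; 5; 4; 6]; [:: 2; 1; 0; 8; 5; 4; 3; 6]; [:: 2; 1; 0; 8; 5; 4; 3; 7]; [:: 3;
  0; 6; 7; 1; 2; 5; 4]; [:: 3; 2; 0; 8; 5; 4; 6; 7]; [:: 3; 4; 0; 5; 1; 2; 6;
  7]; [:: 3; 4; 0; 5; 2; 1; 7; 6]; [:: 4; 3; 0; 5; 1; 2; 7; 6]; [:: 4; 3; 0; 5;
  2; 1; 6; 7]; [:: 4; 5; 0; 6; 1; 2; 3; 8]; [:: 4; 5; 0; 6; 3; 1; 2; 8]; [:: 4;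
  5; 0; 6; 3; 2; 1; 8]; [:: 4; 5; 0; 7; 1; 2; 3; 6]; [:: 4; 5; 0; 7; 3; 2; 1;
  6]; [:: 4; 5; 0; 8; 1; 2; 3; 6]; [:: 5; 0; 1; 8; 2; 3; 4; 6]; [:: 5; 0; 1; 8;
  3; 4; 6; 7]; [:: 5; 0; 1; 8; 4; 3; 6; 7]; [:: 5; 0; 6; 7; 1; 2; 3; 4]; [:: 5;
  0; 6; 7; 1; 4; 3; 2]; [:: 5; 0; 6; 7; 2; 1; 4; 3]; [:: 5; 0; 6; 7; 2; 3; 4;
  8]; [:: 5; 0; 6; 7; 2; 4; 3; 8]; [:: 5; 0; 6; 7; 3; 2; 1; 4]; [:: 5; 0; 6; 8;
  1; 2; 3; 4]; [:: 5; 0; 7; 6; 1; 2; 3; 4]; [:: 5; 0; 8; 7; 1; 2; 3; 4]; [:: 5;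
  1; 0; 6; 4; 3; 2; 8]; [:: 5; 1; 0; 8; 4; 3; 6; 7]; [:: 6; 0; 1; 8; 2; 3; 4;
  5]; [:: 6; 0; 5; 8; 1; 2; 3; 4]; [:: 7; 6; 0; 8; 1; 2; 3; 4]; [:: 7; 6; 0; 8;
  1; 2; 4; 5]; [:: 7; 6; 0; 8; 1; 5; 4; 3]]
  (Node 6 7 [:: Node 0 6 [:: Leaf; Leaf; Leaf; Leaf; Leaf; Leaf; Leaf]; Node 4 6
  [:: Leaf; Leaf; Leaf; Leaf; Leaf; Leaf; Leaf]; Node 3 6 [:: Leaf; Leaf; Leaf;
  Leaf; Leaf; Leaf; Leaf]; Node 4 6 [:: Leaf; Leaf; Leaf; Leaf; Leaf; Leaf;
  Leaf]; Node 4 6 [:: Leaf; Leaf; Leaf; Leaf; Leaf; Leaf; Leaf]; Node 0 6 [::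
  Leaf; Leaf; Leaf; Leaf; Leaf; Leaf; Leaf]; Node 0 6 [:: Leaf; Leaf; Leaf;
  Leaf; Leaf; Leaf; Node 3 7 [:: Leaf; Leaf; Leaf; Leaf; Leaf; Leaf; Leaf;
  Leaf]; Leaf]]).
Proof. by vm_compute. Qed.

(** Vertex 4 is the hub and 0, 1, 2, 3 form the rim. On eight vertices the number of colors excludes
    a core with five vertices, so the wheel has no counterpart there. *)
Lemma wheel4_9_certified : certified 9 16
  [:: (0, 4); (1, 4); (2, 4); (3, 4); (0, 1); (1, 2); (2, 3); (0, 3)]
  [:: [:: 0; 1; 2; 3; 4; 5; 6; 8]; [:: 0; 1; 2; 3; 5; 6; 4; 7]; [:: 0; 1; 2; 3;
  5; 6; 4; 8]; [:: 0; 1; 2; 3; 5; 7; 4; 8]; [:: 0; 1; 2; 3; 6; 4; 5; 7]; [:: 0;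
  1; 2; 3; 6; 5; 4; 7]; [:: 0; 1; 2; 3; 7; 5; 4; 8]; [:: 0; 1; 2; 4; 3; 5; 6;
  8]; [:: 0; 1; 2; 4; 3; 6; 5; 7]; [:: 0; 1; 2; 4; 6; 3; 5; 7]; [:: 0; 1; 2; 4;
  6; 5; 3; 7]; [:: 0; 1; 2; 4; 6; 5; 3; 8]; [:: 0; 1; 4; 2; 5; 6; 3; 7]; [:: 0;
  1; 4; 2; 5; 6; 3; 8]; [:: 0; 1; 4; 2; 5; 7; 3; 8]; [:: 0; 1; 4; 2; 5; 7; 8;
  6]; [:: 0; 1; 4; 2; 6; 5; 3; 7]; [:: 0; 1; 4; 2; 6; 5; 3; 8]; [:: 0; 1; 4; 3;
  2; 6; 5; 7]; [:: 0; 1; 4; 3; 5; 7; 2; 6]; [:: 0; 1; 4; 3; 6; 2; 5; 7]; [:: 0;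
  1; 4; 3; 6; 5; 2; 7]; [:: 0; 1; 4; 3; 6; 5; 2; 8]; [:: 0; 1; 5; 7; 4; 3; 2;
  6]; [:: 0; 2; 3; 4; 1; 7; 5; 6]; [:: 0; 2; 4; 3; 1; 6; 5; 7]; [:: 0; 3; 2; 1;
  5; 6; 4; 8]; [:: 0; 3; 2; 1; 5; 7; 4; 6]; [:: 0; 3; 2; 1; 5; 7; 4; 8]; [:: 0;
  3; 2; 1; 5; 7; 6; 8]; [:: 0; 3; 2; 1; 6; 4; 5; 7]; [:: 0; 3; 2; 1; 6; 5; 4;
  7]; [:: 0; 3; 2; 1; 6; 5; 8; 7]; [:: 0; 3; 2; 1; 7; 5; 4; 8]; [:: 0; 3; 2; 4;
  1; 6; 5; 7]; [:: 0; 3; 2; 4; 5; 6; 1; 8]; [:: 0; 3; 2; 4; 6; 5; 1; 7]; [:: 0;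
  3; 2; 6; 4; 1; 7; 5]; [:: 0; 3; 4; 1; 2; 5; 6; 8]; [:: 0; 3; 4; 1; 5; 6; 2;
  8]; [:: 0; 3; 4; 1; 5; 7; 2; 8]; [:: 0; 3; 4; 2; 5; 6; 1; 7]; [:: 0; 3; 4; 2;
  5; 6; 8; 7]; [:: 0; 3; 4; 2; 5; 7; 1; 8]; [:: 0; 3; 4; 2; 6; 1; 5; 7]; [:: 0;
  3; 4; 2; 6; 5; 1; 8]; [:: 0; 3; 4; 2; 6; 5; 8; 7]; [:: 0; 3; 4; 7; 2; 1; 5;
  6]; [:: 0; 4; 1; 2; 6; 3; 5; 7]; [:: 0; 4; 1; 2; 6; 5; 3; 7]; [:: 0; 4; 1; 2;
  6; 5; 3; 8]; [:: 0; 4; 2; 1; 3; 8; 6; 5]; [:: 0; 4; 2; 1; 5; 6; 3; 7]; [:: 0;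
  4; 2; 1; 5; 6; 3; 8]; [:: 0; 4; 2; 1; 5; 7; 3; 8]; [:: 0; 4; 2; 1; 6; 5; 8;
  7]; [:: 0; 4; 2; 3; 1; 6; 7; 5]; [:: 0; 4; 2; 3; 5; 7; 1; 6]; [:: 0; 4; 2; 3;
  5; 7; 1; 8]; [:: 0; 4; 2; 3; 5; 7; 6; 8]; [:: 0; 4; 2; 3; 6; 1; 5; 7]; [:: 0;
  4; 2; 3; 7; 6; 5; 8]; [:: 0; 4; 3; 2; 1; 8; 6; 5]; [:: 0; 4; 3; 2; 5; 6; 1;
  8]; [:: 0; 4; 3; 2; 6; 1; 5; 7]; [:: 0; 4; 3; 2; 6; 5; 1; 7]; [:: 0; 4; 3; 2;
  6; 5; 1; 8]; [:: 0; 4; 7; 5; 3; 2; 1; 8]; [:: 0; 5; 7; 8; 2; 1; 4; 3]; [:: 0;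
  6; 5; 7; 1; 2; 4; 3]; [:: 0; 6; 5; 8; 1; 4; 2; 3]; [:: 0; 6; 7; 5; 1; 2; 4;
  3]; [:: 0; 7; 5; 6; 2; 1; 4; 3]; [:: 0; 7; 5; 8; 1; 4; 3; 2]; [:: 0; 7; 6; 5;
  1; 2; 4; 3]; [:: 0; 8; 5; 6; 3; 2; 1; 4]; [:: 0; 8; 5; 7; 3; 2; 1; 4]; [:: 0;
  8; 7; 5; 1; 2; 4; 3]; [:: 1; 0; 3; 2; 5; 6; 4; 7]; [:: 1; 0; 3; 2; 5; 6; 4;
  8]; [:: 1; 0; 3; 2; 5; 7; 4; 6]; [:: 1; 0; 3; 2; 5; 7; 4; 8]; [:: 1; 0; 3; 2;
  6; 4; 5; 7]; [:: 1; 0; 3; 2; 6; 5; 4; 7]; [:: 1; 0; 3; 2; 7; 5; 4; 8]; [:: 1;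
  0; 3; 4; 2; 8; 7; 5]; [:: 1; 0; 3; 4; 5; 6; 2; 7]; [:: 1; 0; 3; 4; 6; 2; 5;
  7]; [:: 1; 0; 3; 4; 6; 5; 2; 7]; [:: 1; 0; 3; 4; 6; 5; 2; 8]; [:: 1; 0; 3; 4;
  7; 6; 5; 8]; [:: 1; 0; 4; 2; 6; 3; 5; 7]; [:: 1; 0; 4; 3; 2; 5; 7; 8]; [:: 1;
  0; 4; 3; 5; 6; 2; 8]; [:: 1; 0; 4; 3; 5; 7; 2; 8]; [:: 1; 0; 5; 7; 3; 2; 4;
  6]; [:: 1; 2; 3; 4; 6; 8; 5; 7]; [:: 1; 2; 4; 3; 5; 6; 7; 8]; [:: 1; 2; 4; 3;
  5; 7; 6; 8]; [:: 1; 3; 0; 4; 2; 7; 5; 6]; [:: 1; 4; 0; 3; 2; 8; 6; 5]; [:: 1;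
  4; 0; 3; 5; 7; 2; 6]; [:: 1; 4; 0; 3; 6; 2; 5; 7]; [:: 1; 4; 0; 3; 6; 5; 2;
  7]; [:: 1; 4; 0; 3; 6; 5; 2; 8]; [:: 2; 0; 3; 4; 1; 6; 5; 7]; [:: 2; 1; 0; 3;
  4; 8; 6; 5]; [:: 2; 1; 0; 3; 5; 6; 4; 8]; [:: 2; 1; 0; 3; 5; 6; 8; 7]; [:: 2;
  1; 0; 3; 5; 7; 4; 6]; [:: 2; 1; 0; 3; 5; 7; 4; 8]; [:: 2; 1; 0; 3; 6; 4; 5;
  7]; [:: 2; 1; 0; 3; 6; 5; 4; 7]; [:: 2; 1; 0; 3; 7; 5; 4; 8]; [:: 2; 1; 0; 4;
  3; 5; 7; 8]; [:: 2; 1; 0; 4; 3; 7; 5; 6]; [:: 2; 1; 0; 4; 3; 8; 7; 5]; [:: 2;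
  1; 0; 4; 5; 6; 3; 7]; [:: 2; 1; 0; 4; 5; 6; 3; 8]; [:: 2; 1; 0; 4; 5; 7; 3;
  8]; [:: 2; 1; 0; 8; 3; 4; 6; 5]; [:: 2; 3; 0; 4; 5; 7; 1; 6]; [:: 2; 3; 0; 4;
  5; 7; 1; 8]; [:: 2; 4; 0; 3; 1; 6; 5; 7]; [:: 2; 4; 0; 3; 1; 6; 5; 8]; [:: 2;
  4; 0; 3; 5; 6; 1; 8]; [:: 2; 4; 0; 3; 6; 5; 1; 7]; [:: 2; 4; 0; 3; 6; 5; 1;
  8]; [:: 3; 0; 1; 4; 5; 6; 2; 8]; [:: 3; 0; 1; 4; 5; 6; 7; 8]; [:: 3; 0; 1; 4;
  5; 7; 2; 8]; [:: 3; 0; 1; 4; 6; 8; 5; 7]; [:: 3; 0; 6; 8; 1; 4; 2; 7]; [:: 3;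
  0; 6; 8; 2; 1; 4; 7]; [:: 3; 2; 1; 4; 7; 5; 6; 8]; [:: 4; 0; 1; 8; 3; 2; 6;
  5]; [:: 4; 0; 5; 7; 3; 2; 1; 6]; [:: 4; 1; 0; 6; 3; 2; 7; 8]; [:: 4; 3; 0; 7;
  2; 1; 6; 5]; [:: 4; 3; 0; 8; 2; 1; 6; 5]; [:: 5; 0; 6; 7; 1; 4; 2; 3]; [:: 5;
  6; 0; 7; 1; 2; 3; 4]; [:: 5; 6; 0; 7; 1; 2; 4; 3]; [:: 5; 6; 0; 7; 1; 4; 2;
  3]; [:: 5; 6; 0; 8; 1; 2; 3; 4]; [:: 5; 6; 0; 8; 1; 2; 4; 3]; [:: 5; 6; 0; 8;
  1; 4; 2; 3]; [:: 5; 7; 0; 8; 1; 2; 4; 3]; [:: 5; 7; 0; 8; 1; 4; 2; 3]; [:: 5;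
  7; 0; 8; 3; 2; 1; 4]; [:: 6; 0; 5; 7; 1; 2; 4; 3]; [:: 6; 0; 5; 7; 1; 4; 3;
  2]; [:: 6; 0; 5; 7; 3; 2; 1; 4]; [:: 6; 0; 5; 8; 1; 4; 3; 2]; [:: 6; 5; 0; 7;
  1; 2; 3; 4]; [:: 6; 5; 0; 7; 1; 2; 4; 3]; [:: 6; 5; 0; 7; 1; 4; 2; 3]; [:: 6;
  5; 0; 8; 1; 2; 4; 3]; [:: 6; 5; 0; 8; 1; 4; 2; 3]; [:: 6; 5; 0; 8; 2; 1; 4;
  3]; [:: 7; 5; 0; 8; 1; 4; 3; 2]; [:: 7; 6; 0; 8; 3; 2; 1; 4]]
  (Node 5 6 [:: Node 5 7 [:: Leaf; Leaf; Leaf; Leaf; Leaf; Leaf; Leaf; Leaf; Node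
  6 8 [:: Leaf; Leaf; Leaf; Leaf; Leaf; Leaf; Leaf; Leaf; Leaf; Leaf]]; Node 5 7
  [:: Leaf; Leaf; Leaf; Leaf; Leaf; Leaf; Leaf; Leaf; Node 6 8 [:: Leaf; Leaf;
  Leaf; Leaf; Leaf; Leaf; Leaf; Leaf; Leaf; Leaf]]; Node 5 7 [:: Leaf; Leaf;
  Leaf; Leaf; Leaf; Leaf; Leaf; Leaf; Node 6 8 [:: Leaf; Leaf; Leaf; Leaf; Leaf;
  Leaf; Leaf; Leaf; Leaf; Leaf]]; Node 5 7 [:: Leaf; Leaf; Leaf; Leaf; Leaf;
  Leaf; Leaf; Leaf; Node 6 8 [:: Leaf; Leaf; Leaf; Leaf; Leaf; Leaf; Leaf; Leaf;
  Leaf; Leaf]]; Node 5 7 [:: Leaf; Leaf; Leaf; Leaf; Leaf; Leaf; Leaf; Leaf;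
  Node 6 8 [:: Leaf; Leaf; Leaf; Leaf; Leaf; Leaf; Leaf; Leaf; Leaf; Leaf]];
  Node 5 7 [:: Leaf; Leaf; Leaf; Leaf; Leaf; Leaf; Leaf; Leaf; Node 6 8 [::
  Leaf; Leaf; Leaf; Leaf; Leaf; Leaf; Leaf; Leaf; Leaf; Leaf]]; Node 5 7 [::
  Leaf; Leaf; Leaf; Leaf; Leaf; Leaf; Leaf; Leaf; Node 6 8 [:: Leaf; Leaf; Leaf;
  Leaf; Leaf; Leaf; Leaf; Leaf; Leaf; Leaf]]; Node 5 7 [:: Leaf; Leaf; Leaf;
  Leaf; Leaf; Leaf; Leaf; Leaf; Node 6 8 [:: Leaf; Leaf; Leaf; Leaf; Leaf; Leaf;
  Leaf; Leaf; Leaf; Leaf]]; Node 5 7 [:: Node 7 8 [:: Leaf; Leaf; Leaf; Leaf;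
  Leaf; Leaf; Leaf; Leaf; Leaf; Leaf]; Node 7 8 [:: Leaf; Leaf; Leaf; Leaf;
  Leaf; Leaf; Leaf; Leaf; Leaf; Leaf]; Node 7 8 [:: Leaf; Leaf; Leaf; Leaf;
  Leaf; Leaf; Leaf; Leaf; Leaf; Leaf]; Node 7 8 [:: Leaf; Leaf; Leaf; Leaf;
  Leaf; Leaf; Leaf; Leaf; Leaf; Leaf]; Node 7 8 [:: Leaf; Leaf; Leaf; Leaf;
  Leaf; Leaf; Leaf; Leaf; Leaf; Leaf]; Node 7 8 [:: Leaf; Leaf; Leaf; Leaf;
  Leaf; Leaf; Leaf; Leaf; Leaf; Leaf]; Node 7 8 [:: Leaf; Leaf; Leaf; Leaf;
  Leaf; Leaf; Leaf; Leaf; Leaf; Leaf]; Node 7 8 [:: Leaf; Leaf; Leaf; Leaf;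
  Leaf; Leaf; Leaf; Leaf; Leaf; Leaf]; Node 0 6 [:: Leaf; Leaf; Leaf; Leaf;
  Leaf; Leaf; Leaf; Leaf; Leaf; Node 2 7 [:: Leaf; Leaf; Leaf; Leaf; Leaf; Leaf;
  Leaf; Leaf; Leaf; Leaf; Leaf]]; Node 6 8 [:: Leaf; Leaf; Leaf; Leaf; Leaf;
  Leaf; Leaf; Leaf; Node 0 8 [:: Leaf; Leaf; Leaf; Leaf; Leaf; Leaf; Leaf; Leaf;
  Leaf; Leaf; Node 5 8 [:: Leaf; Leaf; Leaf; Leaf; Leaf; Leaf; Leaf; Leaf; Leaf;
  Leaf; Leaf; Leaf]]; Leaf; Leaf]]]).
Proof. by vm_compute. Qed.

(** * Graphs of minimum degree 3 *)

(** By [permP], explicit lists are permutations of each other once an arbitrary predicate has equal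
    counts on both; its values at the entries are split into cases. *)
Ltac perm_seq :=
  let P := fresh in apply/permP=> P /=;
  repeat match goal with |- context [P ?x] => case: (P x) end; reflexivity.

Section MinDegree3.

Variables (V : finType) (r : rel V).
Hypotheses (r_sym : symmetric r) (r_irr : irreflexive r).
Implicit Types (D : {set V}) (s : seq V).

Definition mindeg3 D := {in D, forall v, 2 < #|[set u in D | r v u]|}.

Definition rpath D s := [&& uniq s, all (mem D) s & sorted r s].

Definition two_rpaths D := exists s t : seq V,
  [/\ size s = 4, size t = 4, uniq (s ++ t), all (mem D) (s ++ t)
    & sorted r s && sorted r t].

Definition spanning_cycle D s :=
  [/\ cycle r s, uniq s, all (mem D) s & {subset D <= s}].

Lemma nbr_avoid D v (l : seq V) : mindeg3 D -> v \in D -> size l <= 2 ->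
  exists u, [/\ u \in D, r v u & u \notin l].
Proof.
move=> dD vD l2; have [u] : exists u, u \in [set u in D | r v u] :\: [set x in l].
  apply/set0Pn; rewrite setD_eq0; apply/negP => /subset_leq_card le_l.
  have := leq_trans (dD v vD) (leq_trans le_l _); move/(_ 2).
  by rewrite ltnn => H; apply/notF/H; rewrite cardsE (leq_trans (card_size l)).
by rewrite !inE => /and3P[ul uD ru]; exists u.
Qed.

Lemma rpath_rev D s : rpath D s -> rpath D (rev s).
Proof.
case/and3P=> us As ss; apply/and3P; split; rewrite ?rev_uniq ?all_rev //.
by rewrite rev_sorted (eq_sorted (e' := r)) // => x y; rewrite r_sym.
Qed.

(** Each new vertex has to avoid at most two earlier ones, since adjacency excludes its predecessor;
    degree 3 suffices for that. *)
Lemma rpath4 D w : mindeg3 D -> w \in D -> exists2 s, rpath D s & size s = 4.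
Proof.
move=> dD wD; have [a [aD wa _]] := nbr_avoid (l := [::]) dD wD isT.
have [b [bD ab]] := nbr_avoid (l := [:: w]) dD aD isT.
have [c [cD bc]] := nbr_avoid (l := [:: w; a]) dD bD isT.
rewrite !inE !negb_or => /andP[cw ca] bw; exists [:: w; a; b; c] => //.
apply/and3P; split=> /=; last by rewrite wa ab bc.
  rewrite !inE !negb_or [w == c]eq_sym cw [a == c]eq_sym ca [w == b]eq_sym bw /= !andbT.
  by apply/and3P; split; apply/eqP => E; move: wa ab bc; rewrite E r_irr.
by rewrite wD aD bD cD.
Qed.

Lemma rpath_extend D x s : rpath D (x :: s) ->
  (exists2 t, rpath D t & size t = (size s).+2) \/
  {in D, forall u, r x u -> u \in s}.
Proof.
case/and3P=> us As ss; case: (pickP [pred u in D | r x u && (u \notin s)]) => [u|no].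
  case/and3P=> uD xu nus; left; exists (u :: x :: s) => //; apply/and3P; split=> //.
  - rewrite cons_uniq us andbT inE negb_or nus andbT.
    by apply: contraTneq xu => ->; rewrite r_irr.
  - by rewrite /= uD.
  - by rewrite /= r_sym xu.
right=> u uD xu; have := no u; rewrite inE /= uD xu /=.
by move/negbT; rewrite negbK.
Qed.

(** A neighbor outside the cycle gives a longer path by opening the cycle at the vertex it is
    adjacent to. If there is none, the rest of [D] keeps minimum degree 3; unless empty it contains
    a P4, disjoint from four consecutive vertices of the cycle. *)
Lemma cycle_extend D s : mindeg3 D -> cycle r s -> uniq s -> all (mem D) s ->
  4 <= size s ->
  [\/ exists2 t, rpath D t & size t = (size s).+1, two_rpaths D
    | spanning_cycle D s].
Proof.
move=> dD cs us As s4.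
case: (boolP [exists x in s, exists y in D, (y \notin s) && r x y]) => [|no].
  case/existsP=> x /andP[xs /existsP[y /and3P[yD nys xy]]].
  have [i p ip] := rot_to xs; apply: Or31; exists (y :: rot i s); last first.
    by rewrite /= size_rot.
  move: cs; rewrite -(rot_cycle i) ip /= rcons_path => /andP[px _].
  apply/and3P; split.
  - by rewrite cons_uniq -ip mem_rot nys rot_uniq us.
  - rewrite /= -/(all _ (x :: p)) -ip yD; apply/allP=> z; rewrite mem_rot; exact: (allP As).
  - by rewrite /= r_sym xy px.
have clo x y : x \in s -> y \in D -> r x y -> y \in s.
  move=> xs yD xy; apply: contraR no => nys.
  by apply/existsP; exists x; rewrite xs; apply/existsP; exists y; rewrite yD nys.
case: (boolP (D \subset s)) => [/subsetP Ds|]; first by apply: Or33.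
case/subsetPn=> w wD nws; apply: Or32.
pose D' := D :\: [set x in s].
have dD' : mindeg3 D'.
  move=> v; rewrite !inE => /andP[nvs vD]; apply: leq_trans (dD v vD) _.
  apply/subset_leq_card/subsetP => u; rewrite !inE => /andP[uD vu].
  rewrite uD vu !andbT; apply: contra nvs => us'; apply: clo us' vD _.
  by rewrite r_sym.
have [t /and3P[ut At st] t4] : exists2 t, rpath D' t & size t = 4.
  by apply: (rpath4 dD' (w := w)); rewrite !inE nws.
exists (take 4 s), t; split=> //.
- by rewrite size_takel.
- rewrite cat_uniq take_uniq // ut andbT; apply/hasPn => x /(allP At).
  by rewrite !inE => /andP[nxs _]; apply: contra nxs; apply: mem_take.
- rewrite all_cat (sub_all _ At) => [|x]; last by rewrite !inE => /andP[].
  by rewrite andbT; apply/allP=> x /mem_take; apply: (allP As).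
- rewrite st andbT take_sorted //; case: (s) cs => //= x p.
  by rewrite rcons_path => /andP[].
Qed.

(** The possible outcomes for a path on [k] vertices. *)
Definition grows D k :=
  [\/ exists2 t, rpath D t & size t = k.+1, two_rpaths D
    | exists2 s, spanning_cycle D s & size s = k].

Lemma cycle_grows D p s : mindeg3 D -> rpath D p -> 4 <= size p ->
  perm_eq p s -> cycle r s -> grows D (size p).
Proof.
move=> dD /and3P[up Ap _] p4 ps cs.
have [|||H|H|H] := cycle_extend dD cs.
- by rewrite -(perm_uniq ps).
- by rewrite -(perm_all _ ps).
- by rewrite -(perm_size ps).
- by apply: Or31; rewrite (perm_size ps).
- exact: Or32.
- by apply: Or33; exists s; rewrite // (perm_size ps).
Qed.

(** Either the path can be prolonged at an end, or both ends have all their neighbors on it. *)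
Lemma rpath_ends D a s z : rpath D (a :: rcons s z) ->
  (exists2 t, rpath D t & size t = (size s).+3) \/
  {in D, forall u, (r a u -> u \in rcons s z) /\ (r z u -> u \in a :: s)}.
Proof.
move=> p; case: (rpath_extend p) => [[t pt st]|Ha].
  by left; exists t; rewrite // st /= size_rcons.
have := rpath_rev p; rewrite rev_cons rev_rcons rcons_cons => p'.
case: (rpath_extend p') => [[t pt st]|Hz].
  by left; exists t; rewrite // st /= size_rcons size_rev.
right=> u uD; split; first exact: Ha.
by move/(Hz u uD); rewrite mem_rcons inE mem_rev -in_cons.
Qed.

Lemma grows4 D s : mindeg3 D -> rpath D s -> size s = 4 -> grows D 4.
Proof.
move=> dD p; case: s p => [|a [|b [|c [|d []]]]] // p _.
case: (rpath_ends (s := [:: b; c]) p) => [H|H]; first exact: Or31.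
have p' := p; case/and3P: p => us As /and4P[ab bc cd _].
have aD : a \in D by case/andP: As.
(* The third neighbor of [a] can only be [d], which closes the path to a cycle. *)
have [u [uD au]] := nbr_avoid (l := [:: b; c]) dD aD isT.
have := (H u uD).1 au; rewrite !inE => /or3P[/eqP->|/eqP->|/eqP ud];
  rewrite ?eqxx ?orbT // => _; rewrite ud in au.
by apply: (cycle_grows dD p' _ (perm_refl _)); rewrite //= ab bc cd r_sym au.
Qed.

(** If the ends [a] and [e] are not adjacent, both are adjacent to all of [b], [c], [d], and the
    chords [ac] and [eb] give another cycle on the same vertices. *)
Lemma grows5 D s : mindeg3 D -> rpath D s -> size s = 5 -> grows D 5.
Proof.
move=> dD p; case: s p => [|a [|b [|c [|d [|e []]]]]] // p _.
case: (rpath_ends (s := [:: b; c; d]) p) => [H|H]; first exact: Or31.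
have p' := p; case/and3P: p => us As /and5P[ab bc cd de _].
case/and5P: (As) => aD bD cD dD' /andP[eD _].
case: (boolP (r a e)) => ae.
  by apply: (cycle_grows dD p' _ (perm_refl _)); rewrite //= ab bc cd de r_sym ae.
have ac : r a c.
  have [u [uD au]] := nbr_avoid (l := [:: b; d]) dD aD isT.
  have := (H u uD).1 au; rewrite !inE => /or4P[]/eqP E;
    by rewrite E ?eqxx ?orbT // in au ae * => _; rewrite ?au // in ae.
have eb : r e b.
  have [u [uD eu]] := nbr_avoid (l := [:: d; c]) dD eD isT.
  have := (H u uD).2 eu; rewrite !inE => /or4P[]/eqP E;
    by rewrite E ?eqxx ?orbT // in eu * => _; rewrite r_sym eu in ae.
apply: (cycle_grows (s := [:: a; b; e; d; c]) dD p') => //.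
  perm_seq.
by rewrite /= ab r_sym eb r_sym de r_sym cd r_sym ac.
Qed.

(** Crossing chords: if [a] is adjacent to an inner vertex and [f] to the one just before it, the
    path closes to a cycle. For nonadjacent ends, [a] meets two of [c], [d], [e] and [f] meets two
    of their predecessors [b], [c], [d], so by pigeonhole some pair of chords crosses. *)
Lemma grows6 D s : mindeg3 D -> rpath D s -> size s = 6 -> grows D 6.
Proof.
move=> dD p; case: s p => [|a [|b [|c [|d [|e [|f []]]]]]] // p _.
case: (rpath_ends (s := [:: b; c; d; e]) p) => [H|H]; first exact: Or31.
have p' := p; case/and3P: p => us As /and5P[ab bc cd de /andP[ef _]].
case/and5P: (As) => aD bD cD dD' /and3P[eD fD _].
have gr s := cycle_grows (s := s) dD p' isT.
case: (boolP (r a f)) => af.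
  by apply: (gr _ (perm_refl _)); rewrite /= ab bc cd de ef r_sym af.
have fromA l : size l <= 2 -> exists u, [/\ r a u, u \in [:: b; c; d; e] & u \notin l].
  case/(nbr_avoid dD aD)=> u [uD au ul]; exists u; split=> //.
  have := (H u uD).1 au; rewrite mem_rcons in_cons => /predU1P[uf|//].
  by rewrite -uf au in af.
have fromF l : size l <= 2 -> exists u, [/\ r f u, u \in [:: b; c; d; e] & u \notin l].
  case/(nbr_avoid dD fD)=> u [uD fu ul]; exists u; split=> //.
  have := (H u uD).2 fu; rewrite in_cons => /predU1P[ua|//].
  by rewrite ua r_sym (negPf af) in fu.
(* At least three of the four inner vertices are neighbors, hence at least one of any two. *)
have pick_of x y z t (P : pred V) :
    (forall l, size l <= 2 -> exists u, [/\ P u, u \in [:: b; c; d; e] & u \notin l]) ->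
    perm_eq [:: b; c; d; e] [:: x; y; z; t] -> P z || P t.
  move=> Pl pe; have [u [Pu + nu]] := Pl [:: x; y] isT.
  rewrite (perm_mem pe) -[[:: x; y; z; t]]/([:: x; y] ++ [:: z; t]) mem_cat (negPf nu) /=.
  by rewrite !inE => /orP[] /eqP <-; rewrite Pu ?orbT.
have := @pick_of b c d e (r a) fromA (perm_refl _).
have := @pick_of b d c e (r a) fromA ltac:(perm_seq).
have := @pick_of b e c d (r a) fromA ltac:(perm_seq).
have := @pick_of d e b c (r f) fromF ltac:(perm_seq).
have := @pick_of c e b d (r f) fromF ltac:(perm_seq).
have := @pick_of b e c d (r f) fromF ltac:(perm_seq).
case: (boolP (r a c && r f b)) => [/andP[ac fb] _ _ _ _ _ _|].
  apply: (gr [:: a; c; d; e; f; b]); last by rewrite /= ac cd de ef fb r_sym ab.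
  perm_seq.
case: (boolP (r a d && r f c)) => [/andP[ad fc] _ _ _ _ _ _ _|].
  apply: (gr [:: a; d; e; f; c; b]).
    perm_seq.
  by rewrite /= ad de ef fc r_sym bc r_sym ab.
case: (boolP (r a e && r f d)) => [/andP[ae fd] _ _ _ _ _ _ _ _|].
  apply: (gr [:: a; e; f; d; c; b]).
    perm_seq.
  by rewrite /= ae ef fd r_sym cd r_sym bc r_sym ab.
by do 6! case: (r _ _) => //=.
Qed.

Lemma mindeg3_structure D : mindeg3 D -> D != set0 ->
  [\/ exists2 t, rpath D t & size t = 7, two_rpaths D
    | exists2 s, spanning_cycle D s & 4 <= size s <= 6].
Proof.
move=> dD /set0Pn[w wD]; have [s4 p4 z4] := rpath4 dD wD.
have [[s5 p5 z5]|H|[s cs zs]] := grows4 dD p4 z4; last 2 first.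
- exact: Or32.
- by apply: Or33; exists s; rewrite // zs.
have [[s6 p6 z6]|H|[s cs zs]] := grows5 dD p5 z5; last 2 first.
- exact: Or32.
- by apply: Or33; exists s; rewrite // zs.
have [H|H|[s cs zs]] := grows6 dD p6 z6.
- exact: Or31.
- exact: Or32.
- by apply: Or33; exists s; rewrite // zs.
Qed.

End MinDegree3.

(** * Saturated colors *)

Lemma set2_eqE (V : finType) (a b x y : V) : a != b ->
  ([set a; b] == [set x; y]) = ((a == x) && (b == y)) || ((a == y) && (b == x)).
Proof.
move=> ab; apply/eqP/idP => [E|/orP[]/andP[/eqP-> /eqP->] //]; last by rewrite setUC.
have := set21 a b; have := set22 a b; rewrite E !inE.
case/orP=> /eqP b' /orP[]/eqP a'; rewrite a' b' ?eqxx ?orbT //; by rewrite a' b' eqxx in ab.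
Qed.

Lemma uniq_path_edges (V : finType) (a b c d e f g h : V) :
  uniq [:: a; b; c; d; e; f; g; h] ->
  uniq [:: [set a; b]; [set b; c]; [set c; d]; [set e; f]; [set f; g]; [set g; h]].
Proof.
(* Inequalities are kept in both directions, as comparing edges produces either. *)
have two s : uniq s -> pairwise (fun x y : V => (x != y) && (y != x)) s.
  by rewrite uniq_pairwise; apply: sub_pairwise => x y; rewrite /= [y == x]eq_sym andbb.
move/two; rewrite /= -!andbA; do ![case/andP=> ?]; move=> _.
rewrite /= !inE !set2_eqE //.
by do !match goal with H : is_true (?x != ?y) |- _ => rewrite ?(negPf H); clear H end.
Qed.

Section Palette.

Variables (V C : finType) (c : {set V} -> C).
Implicit Types (D S : {set V}) (x y z t u v w : V) (k : C).

(** The absence of a rainbow 2P4, spelled out on vertices; [has_rainbow_copyP] provides the link to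
    embeddings. *)
Definition no_rainbow := forall a b c1 d e f g h : V,
  uniq [:: a; b; c1; d; e; f; g; h] ->
  ~~ uniq (map c [:: [set a; b]; [set b; c1]; [set c1; d];
                     [set e; f]; [set f; g]; [set g; h]]).

Definition palette S : {set C} :=
  c @: [set e : {set V} | (e \subset S) && (#|e| == 2)].

Lemma paletteP S k :
  reflect (exists x y, [/\ x \in S, y \in S, x != y & c [set x; y] = k])
          (k \in palette S).
Proof.
apply: (iffP imsetP) => [[e]|[x [y [xS yS xy <-]]]]; last first.
  by exists [set x; y]; rewrite // inE subUset !sub1set xS yS cards2 xy.
rewrite inE => /andP[eS /cards2P[x [y [xy eE]]]] ->; exists x, y; rewrite eE; split=> //.
  by apply: (subsetP eS); rewrite eE set21.
by apply: (subsetP eS); rewrite eE set22.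
Qed.

Lemma paletteS S S' : S \subset S' -> palette S \subset palette S'.
Proof.
move=> SS'; apply/imsetS/subsetP => e; rewrite !inE => /andP[eS ->].
by rewrite (subset_trans eS).
Qed.

Lemma leq_card_palette S : #|palette S| <= 'C(#|S|, 2).
Proof. by rewrite -cards_draws; apply: leq_imset_card. Qed.

(** The colors lost when [v] is deleted from [S]. *)
Definition saturated S v := palette S :\: palette (S :\ v).

Lemma saturatedP S v k x y : k \in saturated S v -> x \in S -> y \in S ->
  x != y -> c [set x; y] = k -> v \in [set x; y].
Proof.
rewrite inE => /andP[nk _] xS yS xy xyk; apply: contraR nk.
rewrite !inE negb_or => /andP[vx vy]; apply/paletteP; exists x, y.
by rewrite !inE eq_sym vx eq_sym vy.
Qed.

Lemma saturated_nbr S v k : k \in saturated S v ->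
  exists u, [/\ u \in S, u != v & c [set v; u] = k].
Proof.
move=> ks; have := ks; rewrite inE => /andP[_ /paletteP[x [y [xS yS xy xyk]]]].
have := saturatedP ks xS yS xy xyk; rewrite !inE => /orP[]/eqP ->.
  by exists y; rewrite eq_sym.
by exists x; rewrite setUC.
Qed.

Lemma card_saturated S v : #|palette S| = #|palette (S :\ v)| + #|saturated S v|.
Proof.
by rewrite -(cardsID (palette (S :\ v)) (palette S)) (setIidPr (paletteS (subsetDl _ _))).
Qed.

Definition core D := [forall v in D, 2 < #|saturated D v|].

(** Deleting a vertex with at most two saturated colors preserves the inequality, so deletion ends
    in a core. *)
Lemma core_exists S d : S != set0 -> 2 * #|S| + d <= #|palette S|.+1 ->
  exists D, [/\ D \subset S, D != set0, core D & 2 * #|D| + d <= #|palette D|.+1].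
Proof.
have [m] := ubnP #|S|; elim: m S => // m IH S Sm S0 le_d.
case: (boolP (core S)) => [cS|]; first by exists S.
case/forall_inPn=> v vS; rewrite -leqNgt => sat2.
have SE := cardsD1 v S; rewrite vS add1n in SE.
have pE := card_saturated S v.
(* A single vertex carries no color, which the inequality forbids. *)
have Sv0 : S :\ v != set0.
  apply/negP => /eqP S0'; have := leq_card_palette S.
  by move: le_d; rewrite SE S0' cards0 bin_small //; lia.
have le_d' : 2 * #|S :\ v| + d <= #|palette (S :\ v)|.+1.
  by move: le_d sat2; rewrite SE pE; lia.
have [|D [DS D0 cD leD]] := IH (S :\ v) _ Sv0 le_d'; first by rewrite -ltnS -SE.
by exists D; split=> //; apply: subset_trans DS (subsetDl _ _).
Qed.

(** * The rainbow graph of a core *)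

Section Core.

Variable D : {set V}.

(* One edge at v for each color saturated at v. *)
Definition arc : rel V := fun v u =>
  [&& v \in D, c [set v; u] \in saturated D v
    & [pick w in D | (w != v) && (c [set v; w] == c [set v; u])] == Some u].

Definition core_edge : rel V := fun v u => arc v u || arc u v.

Lemma arcP v u : arc v u ->
  [/\ v \in D, u \in D, u != v & c [set v; u] \in saturated D v].
Proof.
case/and3P=> vD sk; case: pickP => // w /and3P[wD wv _] /eqP[wu].
by rewrite wu in wD wv.
Qed.

Lemma core_edge_sym : symmetric core_edge.
Proof. by move=> x y; rewrite /core_edge orbC. Qed.

Lemma core_edge_irr : irreflexive core_edge.
Proof. by move=> x; rewrite /core_edge orbb; apply/negP => /arcP[_ _]; rewrite eqxx. Qed.

Lemma core_edgeP x y : core_edge x y -> [/\ x \in D, y \in D & x != y].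
Proof. by case/orP=> /arcP[xD yD xy _]; split=> //; rewrite eq_sym. Qed.

Lemma core_edge_star x y z t : core_edge x y -> z \in D -> t \in D -> z != t ->
  c [set z; t] = c [set x; y] -> (x \in [set z; t]) || (y \in [set z; t]).
Proof.
case/orP=> /arcP[_ _ _ sk] zD tD zt E; rewrite (saturatedP sk zD tD zt) ?orbT //.
by rewrite E setUC.
Qed.

(** Saturation puts [x] on the second edge and [z] on the first. If [x = t] then [z = y]; if
    [x = z], both ends come from the same [pick]. *)
Lemma arc_inj x y z t : arc x y -> arc z t ->
  c [set x; y] = c [set z; t] -> [set x; y] = [set z; t].
Proof.
move=> xy zt E; have [xD yD yx sx] := arcP xy; have [zD tD tz sz] := arcP zt.
have xzt : x \in [set z; t] by apply: saturatedP sx zD tD _ _; rewrite 1?eq_sym.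
have zxy : z \in [set x; y] by apply: saturatedP sz xD yD _ _; rewrite 1?eq_sym.
move: xzt; rewrite !inE => /orP[]/eqP xE; last first.
  move: zxy; rewrite !inE xE eq_sym (negPf tz) /= => /eqP ->; exact: setUC.
case/and3P: xy => _ _ /eqP; case/and3P: zt => _ _ /eqP.
by rewrite xE -E xE => -> [->].
Qed.

Lemma core_edge_inj x y z t : core_edge x y -> core_edge z t ->
  c [set x; y] = c [set z; t] -> [set x; y] = [set z; t].
Proof.
case/orP=> H /orP[] H'.
- exact: arc_inj.
- by rewrite [in RHS]setUC => E; rewrite (arc_inj H H' E) setUC.
- by rewrite setUC => E; rewrite (arc_inj H H' E).
- by rewrite setUC [[set z; t]]setUC; apply: arc_inj.
Qed.

Lemma core_edge_uniq (es : seq {set V}) :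
  {in es, forall e, exists x y, core_edge x y /\ e = [set x; y]} ->
  uniq es -> uniq (map c es).
Proof.
move=> H; rewrite map_inj_in_uniq // => e e' /H[x [y [xy ->]]] /H[z [t [zt ->]]].
exact: core_edge_inj.
Qed.

(** The map [nb], from a color saturated at [v] to the neighbor picked for it, is injective, so
    three such colors give three neighbors. *)
Lemma core_mindeg3 : core D -> mindeg3 core_edge D.
Proof.
move=> cD v vD; apply: leq_trans (forall_inP cD v vD) _.
pose nb k := odflt v [pick w in D | (w != v) && (c [set v; w] == k)].
have nbP k : k \in saturated D v ->
    [/\ nb k \in D, c [set v; nb k] = k
      & [pick w in D | (w != v) && (c [set v; w] == k)] = Some (nb k)].
  move=> ks; rewrite /nb; case: pickP => [w /and3P[wD _ /eqP]|no] //=.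
  have [u [uD uv uk]] := saturated_nbr ks.
  by have := no u; rewrite /= uD uv uk eqxx.
rewrite -(card_in_imset (f := nb)); last first.
  by move=> k k' /nbP[_ kE _] /nbP[_ kE' _] E; rewrite -kE E.
apply/subset_leq_card/subsetP => _ /imsetP[k ks ->]; have [nD nk np] := nbP k ks.
by rewrite inE nD /core_edge /arc vD nk ks np eqxx.
Qed.

Hypothesis nr : no_rainbow.

Lemma core_edges_list (ps : seq (V * V)) : all (fun p => core_edge p.1 p.2) ps ->
  uniq [seq [set p.1; p.2] | p <- ps] -> uniq [seq c [set p.1; p.2] | p <- ps].
Proof.
move=> /allP cp u; rewrite (map_comp c (fun p : V * V => [set p.1; p.2])).
apply: core_edge_uniq u => _ /mapP[p /cp pp ->]; by exists p.1, p.2.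
Qed.

Lemma no_two_rpaths : ~ two_rpaths core_edge D.
Proof.
case=> s [t [zs zt u _ /andP[]]].
case: s zs u => [|p1 [|p2 [|p3 [|p4 []]]]] //; case: t zt => [|q1 [|q2 [|q3 [|q4 []]]]] //.
move=> _ _ u /and4P[e1 e2 e3 _] /and4P[f1 f2 f3 _].
apply/negP: (nr u); rewrite negbK.
apply: (@core_edges_list [:: (p1, p2); (p2, p3); (p3, p4); (q1, q2); (q2, q3); (q3, q4)]).
  by rewrite /= e1 e2 e3 f1 f2 f3.
exact: uniq_path_edges.
Qed.

(** The paths [p1 p2 p3 p4] and [w x y z] form a 2P4, so the color of [wx] repeats that of one of
    the other five edges. These are core edges, and by [core_edge_star] the repeated one meets [w]
    or [x]; only [xy] does. *)
Lemma tail_color p1 p2 p3 p4 w x y z :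
  uniq [:: p1; p2; p3; p4; w; x; y; z] -> w \in D ->
  sorted core_edge [:: p1; p2; p3; p4] -> sorted core_edge [:: x; y; z] ->
  c [set w; x] = c [set x; y].
Proof.
move=> u wD /and4P[e1 e2 e3 _] /and3P[f1 f2 _].
have xD : x \in D by case/core_edgeP: f1.
have := nr u; have := uniq_path_edges u.
set l := [:: (p1, p2); (p2, p3); (p3, p4); (x, y); (y, z)].
move=> ue.
have ul : uniq [seq c [set p.1; p.2] | p <- l].
  apply: core_edges_list; first by rewrite /= e1 e2 e3 f1 f2.
  exact: (subseq_uniq (mask_subseq [:: true; true; true; false; true; true] _) ue).
have wx : w != x by move: u; rewrite /= !inE; case: (w == x); rewrite ?andbF.
rewrite (perm_uniq (s2 := c [set w; x] :: [seq c [set p.1; p.2] | p <- l])); last first.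
  perm_seq.
rewrite cons_uniq ul andbT negbK => /mapP[[a b] abl E].
have ab : core_edge a b.
  by move: abl; rewrite !inE => /or4P[|||/orP[]] /eqP[-> ->].
have := core_edge_star ab wD xD wx E.
have nin v : v \in [set w; x] -> v \notin [:: p1; p2; p3; p4; y; z].
  have : uniq ([:: w; x] ++ [:: p1; p2; p3; p4] ++ [:: y; z]) by rewrite uniq_catCA.
  by rewrite cat_uniq => /and3P[_ /hasPn H _]; apply: contraL => /H; rewrite !inE.
have := core_edge_star ab wD xD wx E.
move: abl; rewrite in_cons => /predU1P[|].
  by case=> -> -> /orP[] /nin; rewrite !inE eqxx ?orbT.
rewrite in_cons => /predU1P[|].
  by case=> -> -> /orP[] /nin; rewrite !inE eqxx ?orbT.
rewrite in_cons => /predU1P[|].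
  by case=> -> -> /orP[] /nin; rewrite !inE eqxx ?orbT.
rewrite in_cons => /predU1P[[aE bE]|].
  by move: E; rewrite aE bE.
rewrite inE => /eqP[-> ->].
by case/orP=> /nin; rewrite !inE eqxx ?orbT.
Qed.

(** The path splits into four and three vertices in two ways, and [tail_color] applies at either end
    of the part with three vertices. *)
Lemma path7_colors p1 p2 p3 p4 p5 p6 p7 w :
  uniq [:: w; p1; p2; p3; p4; p5; p6; p7] -> w \in D ->
  sorted core_edge [:: p1; p2; p3; p4; p5; p6; p7] ->
  [/\ c [set w; p1] = c [set p1; p2], c [set w; p3] = c [set p3; p2],
     c [set w; p5] = c [set p5; p6] & c [set w; p7] = c [set p7; p6]].
Proof.
move=> u wD /and5P[e1 e2 e3 e4 /and3P[e5 e6 _]]; have sym := core_edge_sym.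
have up s : perm_eq [:: w; p1; p2; p3; p4; p5; p6; p7] s -> uniq s.
  by move=> ps; rewrite -(perm_uniq ps).
have [f1 f2 f4 f5 f6] : [/\ core_edge p2 p1, core_edge p3 p2, core_edge p5 p4,
    core_edge p6 p5 & core_edge p7 p6] by split; rewrite sym.
split.
- apply: (@tail_color p7 p6 p5 p4 w p1 p2 p3) => //.
  + apply: up; perm_seq.
  + by rewrite /= f6 f5 f4.
  + by rewrite /= e1 e2.
- apply: (@tail_color p7 p6 p5 p4 w p3 p2 p1) => //.
  + apply: up; perm_seq.
  + by rewrite /= f6 f5 f4.
  + by rewrite /= f2 f1.
- apply: (@tail_color p1 p2 p3 p4 w p5 p6 p7) => //.
  + apply: up; perm_seq.
  + by rewrite /= e1 e2 e3.
  + by rewrite /= e5 e6.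
- apply: (@tail_color p1 p2 p3 p4 w p7 p6 p5) => //.
  + apply: up; perm_seq.
  + by rewrite /= e1 e2 e3.
  + by rewrite /= f6 f5.
Qed.

Lemma core_edge_center x y : core_edge x y -> exists2 v, v \in [set x; y] &
  forall z t, z \in D -> t \in D -> z != t -> c [set z; t] = c [set x; y] ->
    v \in [set z; t].
Proof.
case/orP=> /arcP[_ _ _ sk]; [exists x | exists y]; rewrite ?set21 ?set22 //.
  by move=> z t zD tD zt E; apply: (saturatedP sk).
by move=> z t zD tD zt E; apply: (saturatedP sk zD tD zt); rewrite E setUC.
Qed.

(** Within [D] the color of a core edge forms a star, and a star contains no triangle. *)
Lemma core_edge_no_triangle x y z : core_edge x y -> z \in D ->
  z != x -> z != y -> c [set z; x] = c [set x; y] -> c [set z; y] != c [set x; y].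
Proof.
move=> xy zD zx zy Ex; apply/negP => /eqP Ey; have [xD yD ne] := core_edgeP xy.
have [v + cv] := core_edge_center xy.
have := cv z x zD xD zx Ex; have := cv z y zD yD zy Ey.
rewrite !inE; move/eqP: ne; move/eqP: zx; move/eqP: zy => zy zx ne.
by case/orP=> /eqP E1 /orP[]/eqP E2 /orP[]/eqP E3; congruence.
Qed.

Lemma core_edge_neq x y z : core_edge x y -> core_edge x z -> y != z ->
  c [set x; y] != c [set x; z].
Proof.
move=> xy xz; apply: contraNneq => /(core_edge_inj xy xz) /eqP.
have [_ _ ne] := core_edgeP xy.
by rewrite set2_eqE // eqxx /= => /orP[//|/andP[_ /eqP yx]]; rewrite yx eqxx in ne.
Qed.

Lemma leq_card_core : core D -> #|D| <= 7.
Proof.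
move=> cD; have sym := core_edge_sym.
have [->|D0] := eqVneq D set0; first by rewrite cards0.
have [[s]|/no_two_rpaths //|[s [_ _ _ Ds]]] :=
  mindeg3_structure core_edge_sym core_edge_irr (core_mindeg3 cD) D0; last first.
  case/andP=> _ s6; apply: leq_trans (leq_trans s6 (leqnSn _)).
  apply: leq_trans (card_size s); apply/subset_leq_card/subsetP; exact: Ds.
case: s => [|v1 [|v2 [|v3 [|v4 [|v5 [|v6 [|v7 []]]]]]]] // /and3P[us As ss] _.
rewrite leqNgt; apply/negP => D8.
have [w wD ws] : exists2 w, w \in D & w \notin [:: v1; v2; v3; v4; v5; v6; v7].
  apply/subsetPn; apply/negP => /subset_leq_card /leq_trans/(_ (card_size _)).
  by rewrite leqNgt D8.
have out x : x \in D -> x \notin [:: v1; v2; v3; v4; v5; v6; v7] ->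
    [/\ c [set x; v1] = c [set v1; v2], c [set x; v3] = c [set v3; v2],
        c [set x; v5] = c [set v5; v6] & c [set x; v7] = c [set v7; v6]].
  by move=> xD xs; apply: path7_colors ss => //; rewrite cons_uniq xs.
have [w1 w3 w5 w7] := out w wD ws.
have uw : uniq [:: w; v1; v2; v3; v4; v5; v6; v7] by rewrite cons_uniq ws.
have up s : perm_eq [:: w; v1; v2; v3; v4; v5; v6; v7] s -> uniq s.
  by move=> ps; rewrite -(perm_uniq ps).
have /and5P[e1 e2 e3 e4 /and3P[e5 e6 _]] := ss.
have v1D : v1 \in D by case/andP: As.
have wv x : x \in [:: v1; v2; v3; v4; v5; v6; v7] -> w != x.
  by apply: contraTneq => <-.
(* Since [w v3] already has the color of [v2 v3], equality would produce a triangle in that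
   color. *)
have tri : c [set w; v2] != c [set v2; v3].
  have nwv2 : w != v2 by apply: wv; rewrite !inE eqxx orbT.
  have nwv3 : w != v3 by apply: wv; rewrite !inE eqxx !orbT.
  apply/negP => /eqP w2; have /eqP[] := core_edge_no_triangle e2 wD nwv2 nwv3 w2.
  by rewrite w3 setUC.
(* The vertex [v4] is avoided because rerouting along a chord [v1 v4] forces only colors that are
   already known. *)
have [u [uD v1u]] := nbr_avoid (l := [:: v2; v4]) (core_mindeg3 cD) v1D isT.
rewrite !inE negb_or => /andP[u2 u4].
(* If [u] is off the path, the core edges [v1 u] and [v1 v2] get the same color. *)
case: (boolP (u \in [:: v1; v2; v3; v4; v5; v6; v7])) => [|/(out _ uD)[E _ _ _]]; last first.
  have /eqP[] := core_edge_neq v1u e1 u2.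
  by rewrite setUC.
have [f1 f2 f3 f4 f5] : [/\ core_edge v2 v1, core_edge v3 v2, core_edge v4 v3,
    core_edge v5 v4 & core_edge v6 v5] by split; rewrite sym.
(* Each chord reroutes the path on the same seven vertices. The colors forced at [w] then contradict
   those at [v3] or [v5], or give [w v2] the color of [v2 v3]. *)
rewrite !inE (negPf u2) (negPf u4) /=; case/or4P=> [/eqP E|/eqP E|/eqP E|/orP[/eqP E|/eqP E]].
- by move: v1u; rewrite E core_edge_irr.
- rewrite E in v1u; have v31 : core_edge v3 v1 by rewrite sym.
  have [||_ w3' _ _] := @path7_colors v2 v1 v3 v4 v5 v6 v7 w _ wD.
  + apply: up; perm_seq.
  + by rewrite /= f1 v1u e3 e4 e5 e6.
  have := core_edge_neq v31 f2; rewrite -w3' -w3 eqxx => H.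
  by apply/notF/H; move: us; rewrite /= !inE; case: eqP.
- rewrite E in v1u.
  have [||_ w2 _ _] := @path7_colors v4 v3 v2 v1 v5 v6 v7 w _ wD.
  + apply: up; perm_seq.
  + by rewrite /= f3 f2 f1 v1u e5 e6.
  by rewrite w2 eqxx in tri.
- rewrite E in v1u; have [||w5' _ _ _] := @path7_colors v5 v4 v3 v2 v1 v6 v7 w _ wD.
  + apply: up; perm_seq.
  + by rewrite /= f4 f3 f2 f1 v1u e6.
  have := core_edge_neq f4 e5; rewrite -w5' -w5 eqxx => H.
  by apply/notF/H; move: us; rewrite /= !inE; case: (v4 =P v6); rewrite ?orbT ?andbF.
- rewrite E in v1u; have v71 : core_edge v7 v1 by rewrite sym.
  have [||w2 _ _ _] := @path7_colors v2 v3 v4 v5 v6 v7 v1 w _ wD.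
  + apply: up; perm_seq.
  + by rewrite /= e2 e3 e4 e5 e6 v71.
  by rewrite w2 eqxx in tri.
Qed.

End Core.
End Palette.

(** * The upper bound *)

Section Upper.

Variables (V C : finType) (c : {set V} -> C).
Hypothesis nr : no_rainbow c.
Implicit Types (D S : {set V}).

Definition indexed_color (g : seq V) (x0 : V) (e : edge) : C :=
  c [set nth x0 g e.1; nth x0 g e.2].

Lemma mk_edge_color g x0 i j :
  indexed_color g x0 (mk_edge i j) = c [set nth x0 g i; nth x0 g j].
Proof. by rewrite /mk_edge; case: ifP => // _; rewrite /indexed_color setUC. Qed.

Lemma leq_card_palette_certified m b st paths t (g : seq V) x0 :
  certified m b st paths t -> uniq g -> size g = m ->
  uniq (map (indexed_color g x0) st) -> #|palette c [set x in g]| <= b.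
Proof.
move=> cert ug sg ust.
(* The value [c set0] is only a default color for [nth]. *)
apply: leq_trans (certified_sound (c set0) cert _ ust); last first.
  move=> [|v0 [|v1 [|v2 [|v3 [|v4 [|v5 [|v6 [|v7 []]]]]]]]] //.
  set v := [:: v0; v1; v2; v3; v4; v5; v6; v7] => _ uv av.
  have ugv : uniq (map (nth x0 g) v).
    rewrite map_inj_in_uniq // => i j /(allP av) iv /(allP av) jv /eqP.
    by rewrite nth_uniq ?sg // => /eqP.
  by have := nr ugv; rewrite /two_paths /= !mk_edge_color.
set s := undup _; apply: leq_trans (card_size s).
apply/subset_leq_card/subsetP => k /paletteP[x [y []]].
rewrite !inE mem_undup => xg yg xy <-.
have [ix iy] : index x g < m /\ index y g < m by rewrite -sg !index_mem.
apply/mapP; exists (mk_edge (index x g) (index y g)); last first.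
  by rewrite mk_edge_color !nth_index.
rewrite mem_rev mem_filter /mk_edge.
case: (ltngtP (index x g) (index y g)) => [lt|lt|E].
- by rewrite /= lt allpairs_f ?mem_iota.
- by rewrite /= lt allpairs_f ?mem_iota.
- by move: xy; rewrite -(nth_index x0 xg) E nth_index ?eqxx.
Qed.

(** The configuration [s] is completed to an enumeration of [S]; the starting edges only see the
    positions in [s]. *)
Lemma leq_card_palette_start m b st paths t S (s : seq V) x0 :
  certified m b st paths t -> #|S| = m -> uniq s -> {subset s <= S} ->
  all (fun e : edge => (e.1 < size s) && (e.2 < size s)) st ->
  uniq (map (indexed_color s x0) st) -> #|palette c S| <= b.
Proof.
move=> cert Sm us sS st_s ust; pose g := s ++ enum (S :\: [set x in s]).
have gS x : (x \in g) = (x \in S).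
  rewrite mem_cat mem_enum !inE; case: (boolP (x \in s)) => //= /sS ->.
  by [].
have ug : uniq g.
  rewrite cat_uniq us enum_uniq andbT; apply/hasPn => x.
  by rewrite mem_enum !inE => /andP[].
have -> : S = [set x in g] by apply/setP=> x; rewrite inE gS.
apply: (leq_card_palette_certified cert ug (x0 := x0)).
  by rewrite -Sm -(card_uniqP ug); apply: eq_card => x; rewrite gS.
suff -> : map (indexed_color g x0) st = map (indexed_color s x0) st by [].
apply/eq_in_map => e /(allP st_s)/andP[e1 e2].
by rewrite /indexed_color !nth_cat e1 e2.
Qed.

(** Every vertex lies on at least one of its two possible chords. If none had both, the chords would
    match five vertices perfectly, which parity forbids; so some vertex is adjacent to all others.
    The other four then span a cycle, as each of them misses at most one vertex. *)
Lemma wheel_of_cycle5 (r : rel V) D (s : seq V) : symmetric r -> irreflexive r ->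
  mindeg3 r D -> spanning_cycle r D s -> size s = 5 ->
  exists a b d e h, [/\ uniq [:: a; b; d; e; h], {subset [:: a; b; d; e; h] <= D},
    cycle r [:: a; b; d; e] & all (r h) [:: a; b; d; e]].
Proof.
move=> sym irr dD; case: s => [|a [|b [|d [|e [|f []]]]]] // [+ us /allP As Ds] _.
case/and5P=> ab bd de ef /andP[fa _].
have two x y z t u : perm_eq [:: a; b; d; e; f] [:: x; y; z; t; u] -> r x t || r x u.
  move=> pe; have xD : x \in D by apply: As; rewrite (perm_mem pe) mem_head.
  have [v [vD xv]] := nbr_avoid (l := [:: y; z]) dD xD isT.
  have := Ds v vD; rewrite (perm_mem pe) !inE negb_or => + /andP[vy vz].
  rewrite (negPf vy) (negPf vz) /=.
  by case/or3P=> /eqP E; rewrite E ?irr // in xv; rewrite xv ?orbT.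
have ta : r a d || r a e.
  by apply: (@two a b f); perm_seq.
have tb : r b e || r b f.
  by apply: (@two b a d); perm_seq.
have td : r f d || r a d.
  by rewrite [r f d]sym [r a d]sym; apply: (@two d b e); perm_seq.
have te : r a e || r b e.
  by rewrite [r a e]sym [r b e]sym; apply: (@two e d f); perm_seq.
have tf : r b f || r f d.
  by rewrite [r b f]sym; apply: (@two f a e); perm_seq.
have wheel h x y z t : perm_eq [:: a; b; d; e; f] [:: x; y; z; t; h] ->
    cycle r [:: x; y; z; t] -> all (r h) [:: x; y; z; t] ->
    exists a b d e h, [/\ uniq [:: a; b; d; e; h], {subset [:: a; b; d; e; h] <= D},
      cycle r [:: a; b; d; e] & all (r h) [:: a; b; d; e]].
  move=> pe cy ah; exists x, y, z, t, h; split=> //; first by rewrite -(perm_uniq pe).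
  by move=> v; rewrite -(perm_mem pe) => /As.
have flip x y : r x y -> r y x by rewrite sym.
have [ba db ed fe af] : [/\ r b a, r d b, r e d, r f e & r a f] by split; apply: flip.
have hub x y z t u : perm_eq [:: a; b; d; e; f] [:: x; y; z; t; u] ->
    cycle r [:: x; y; z; t; u] -> r x z -> r x t -> r y u || (r y t && r z u) ->
    exists a b d e h, [/\ uniq [:: a; b; d; e; h], {subset [:: a; b; d; e; h] <= D},
      cycle r [:: a; b; d; e] & all (r h) [:: a; b; d; e]].
  move=> pe /and5P[xy yz zt tu /andP[ux _]] xz xt /orP[yu|/andP[yt zu]].
    apply: (@wheel x y z t u).
    - by rewrite (perm_trans pe) // -(perm_rot 1).
    - by rewrite /= yz zt tu flip.
    - by rewrite /= xy xz xt flip.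
  apply: (@wheel x y z u t).
  - by rewrite (perm_trans pe) //; perm_seq.
  - by rewrite /= yz zu [r u t]flip // [r t y]flip.
  - by rewrite /= xy xz xt [r x u]flip.
rewrite [r f d]sym in td tf.
have [/andP[ad ae]|] := boolP (r a d && r a e).
  apply: (@hub a b d e f); rewrite ?perm_refl //=; first by rewrite ab bd de ef fa.
  by case: (r b f) tb tf => //=; rewrite orbF => ->.
have [/andP[be bf] _|] := boolP (r b e && r b f).
  apply: (@hub b d e f a); rewrite //= ?ab ?bd ?de ?ef ?fa //.
    perm_seq.
  rewrite [r d a]sym [r e a]sym.
  by case: (r a d) ta td => //=; rewrite orbF => -> ->.
have [/andP[df ad] _ _|] := boolP (r d f && r a d).
  apply: (@hub d e f a b); rewrite //= ?ab ?bd ?de ?ef ?fa // 1?[r d a]sym //.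
    perm_seq.
  rewrite [r e b]sym [r e a]sym [r f b]sym.
  by case: (r b e) tb te => //=; rewrite orbF => -> ->.
have [/andP[ae be] _ _ _|] := boolP (r a e && r b e).
  apply: (@hub e f a b d); rewrite //= ?ab ?bd ?de ?ef ?fa // 1?[r e a]sym 1?[r e b]sym //.
    perm_seq.
  rewrite [r f d]sym [r f b]sym.
  by case: (r d f) td tf => //=; rewrite orbF => -> ->.
have [/andP[bf df] _ _ _ _|] := boolP (r b f && r d f).
  apply: (@hub f a b d e); rewrite //= ?ab ?bd ?de ?ef ?fa // 1?[r f b]sym 1?[r f d]sym //.
    perm_seq.
  by case: (r a e) ta te => //=; rewrite orbF => -> ->.
move: ta tb td te tf.
by case: (r a d); case: (r a e); case: (r b e); case: (r b f); case: (r d f).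
Qed.

Lemma core_edges_colors D (x0 : V) (s : seq V) (st : seq edge) :
  all (fun e : edge => core_edge c D (nth x0 s e.1) (nth x0 s e.2)) st ->
  uniq [seq [set nth x0 s e.1; nth x0 s e.2] | e <- st] ->
  uniq (map (indexed_color s x0) st).
Proof.
move=> /allP H u; rewrite (map_comp c (fun e : edge => [set nth x0 s e.1; nth x0 s e.2])).
apply: (@core_edge_uniq _ _ c D) => // _ /mapP[e /H ee ->].
by exists (nth x0 s e.1), (nth x0 s e.2).
Qed.

Lemma uniq_indexed_sets (x0 : V) (s : seq V) (st : seq edge) : uniq s -> uniq st ->
  all (fun e : edge => (e.1 < e.2) && (e.2 < size s)) st ->
  uniq [seq [set nth x0 s e.1; nth x0 s e.2] | e <- st].
Proof.
move=> us ust /allP H; rewrite map_inj_in_uniq // => -[i j] [k l].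
move=> /H /andP[/= ij js] /H /andP[/= kl ls].
have [is_ ks] : i < size s /\ k < size s by by rewrite (ltn_trans ij js) (ltn_trans kl ls).
move/eqP; rewrite set2_eqE ?nth_uniq ?(ltn_eqF ij) //.
case/orP=> /andP[/eqP E /eqP F]; first by rewrite E F.
by move: ij; rewrite E F ltnNge ltnW.
Qed.

Lemma leq_card_palette_core m b st paths t S D (s : seq V) :
  certified m b st paths t -> #|S| = m -> uniq s -> {subset s <= S} ->
  uniq st -> all (fun e : edge => (e.1 < e.2) && (e.2 < size s)) st ->
  (forall x0, all (fun e : edge => core_edge c D (nth x0 s e.1) (nth x0 s e.2)) st) ->
  #|palette c S| <= b.
Proof.
move=> cert Sm us sS ust st_s cst.
have [->|/set0Pn[x0 _]] := eqVneq S set0.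
  by rewrite (leq_trans (leq_card_palette _ _)) // cards0.
apply: (leq_card_palette_start cert Sm us sS (x0 := x0)).
  by apply: sub_all st_s => e /andP[e12 e2]; rewrite e2 (ltn_trans e12).
apply: core_edges_colors (cst x0) _; exact: uniq_indexed_sets.
Qed.

Lemma leq_card_palette_base S : #|S| = 8 \/ #|S| = 9 -> #|palette c S| <= 16.
Proof.
move=> S89; rewrite leqNgt; apply/negP => lt16.
(* With 17 colors, [2 * #|S| + d] is 18 in both cases, exactly what [core_exists] allows. *)
pose d := if #|S| == 8 then 2 else 0.
have S0 : S != set0 by rewrite -card_gt0; case: S89 => ->.
have led : 2 * #|S| + d <= #|palette c S|.+1 by rewrite /d; case: S89 => -> /=; lia.
have [D [DS D0 cD leD]] := core_exists S0 led.
have sub s : all (mem D) s -> {subset s <= S}.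
  by move=> /allP As x /As; apply: (subsetP DS).
have sym := @core_edge_sym _ _ c D; have irr := @core_edge_irr _ _ c D.
have [[s]|/(no_two_rpaths nr) //|[s]] := mindeg3_structure sym irr (core_mindeg3 cD) D0.
  case/and3P=> us As ss s7.
  case: s us As ss s7 => [|v1 [|v2 [|v3 [|v4 [|v5 [|v6 [|v7 []]]]]]]] // us As ss _.
  have {}ss x0 : all (fun e : edge => core_edge c D
      (nth x0 [:: v1; v2; v3; v4; v5; v6; v7] e.1)
      (nth x0 [:: v1; v2; v3; v4; v5; v6; v7] e.2))
      [:: (0, 1); (1, 2); (2, 3); (3, 4); (4, 5); (5, 6)].
    exact: ss.
  move: lt16; rewrite ltnNge; case: S89 => S89.
    by rewrite (leq_card_palette_core path7_8_certified S89 us (sub _ As) _ _ ss).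
  by rewrite (leq_card_palette_core path7_9_certified S89 us (sub _ As) _ _ ss).
move=> sc; have [cs us As Ds] := sc.
have DE : #|D| = size s.
  rewrite -(card_uniqP us); apply: eq_card => x; apply/idP/idP; first exact: Ds.
  exact: (allP As).
case/andP=> s4; rewrite leq_eqVlt => /predU1P[s6|].
  case: s cs us As s6 {sc Ds DE s4} => [|v1 [|v2 [|v3 [|v4 [|v5 [|v6 []]]]]]] // cs us As _.
  have {}cs x0 : all (fun e : edge => core_edge c D
      (nth x0 [:: v1; v2; v3; v4; v5; v6] e.1) (nth x0 [:: v1; v2; v3; v4; v5; v6] e.2))
      [:: (0, 1); (1, 2); (2, 3); (3, 4); (4, 5); (0, 5)].
    by move: cs; rewrite /= [core_edge c D v6 v1]sym.
  move: lt16; rewrite ltnNge; case: S89 => S89.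
    by rewrite (leq_card_palette_core cycle6_8_certified S89 us (sub _ As) _ _ cs).
  by rewrite (leq_card_palette_core cycle6_9_certified S89 us (sub _ As) _ _ cs).
rewrite ltnS => s5; have := leq_card_palette c D; rewrite DE => le_bin.
(* A core on 4 or 5 vertices has at most 6 or 10 colors, while at least [2 * #|D| + d - 1] are
   present; this leaves only [#|D| = 5] with [d = 0]. *)
have S9 : #|S| = 9.
  case: S89 => // S8; move: leD; rewrite /d S8 eqxx DE.
  by case: (size s) s4 s5 le_bin => [|[|[|[|[|[|]]]]]] //= _ _; rewrite ?bin2 /=; lia.
have {s4} {}s5 : size s = 5.
  move: leD; rewrite DE.
  by case: (size s) s4 s5 le_bin => [|[|[|[|[|[|]]]]]] //= _ _; rewrite ?bin2 /=; lia.
have [v0 [v1 [v2 [v3 [h [uw Aw cw hw]]]]]] := wheel_of_cycle5 sym irr (core_mindeg3 cD) sc s5.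
have {}cw x0 : all (fun e : edge => core_edge c D
    (nth x0 [:: v0; v1; v2; v3; h] e.1) (nth x0 [:: v0; v1; v2; v3; h] e.2))
    [:: (0, 4); (1, 4); (2, 4); (3, 4); (0, 1); (1, 2); (2, 3); (0, 3)].
  move: cw hw => /and5P[w0 w1 w2 w3 _] /and5P[h0 h1 h2 h3 _].
  by rewrite /= w0 w1 w2 sym h0 sym h1 sym h2 sym h3 sym w3.
move: lt16; rewrite ltnNge (leq_card_palette_core wheel4_9_certified S9 uw _ _ _ cw) //.
by move=> x /Aw; apply: (subsetP DS).
Qed.

(** From ten vertices on, [S] is too large to be a core, so some vertex can be deleted at the cost
    of at most two colors. For nine vertices both terms of the maximum are 16. *)
Lemma leq_card_palette_max S : 8 <= #|S| -> #|palette c S| <= maxn (2 * #|S| - 2) 16.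
Proof.
have [m] := ubnP #|S|; elim: m S => // m IH S Sm S8.
have [S9|S10] := leqP #|S| 9.
  by apply: leq_trans (leq_maxr _ _); apply: leq_card_palette_base; lia.
have [cS|] := boolP (core c S); first by have := leq_card_core nr cS; lia.
case/forall_inPn=> v vS; rewrite -leqNgt => sat2.
have SE := cardsD1 v S; rewrite vS add1n in SE.
have := IH (S :\ v); rewrite (card_saturated c S v); lia.
Qed.

End Upper.

(** * The lower bound *)

Local Notation two_P4 := (disjoint_union (path_graph 4) (path_graph 4)).

(** * Copies of two disjoint P4 given by eight vertices *)

Section TwoP4.

Let o0 : 'I_4 := @Ordinal 4 0 isT.
Let o1 : 'I_4 := @Ordinal 4 1 isT.
Let o2 : 'I_4 := @Ordinal 4 2 isT.
Let o3 : 'I_4 := @Ordinal 4 3 isT.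

Let two_P4_edges : seq {set two_P4} :=
  [:: [set inl o0; inl o1]; [set inl o1; inl o2]; [set inl o2; inl o3];
      [set inr o0; inr o1]; [set inr o1; inr o2]; [set inr o2; inr o3]].

Let two_P4_vertices : seq two_P4 :=
  [:: inl o0; inl o1; inl o2; inl o3; inr o0; inr o1; inr o2; inr o3].

Let ord4 (i : 'I_4) : [\/ i = o0, i = o1, i = o2 | i = o3].
Proof.
by case: i => [[|[|[|[|]]]] ilt] //;
  [apply: Or41 | apply: Or42 | apply: Or43 | apply: Or44]; apply: val_inj.
Qed.

Lemma perm_two_P4_edges : perm_eq (enum (edges two_P4)) two_P4_edges.
Proof.
apply: uniq_perm; [exact: enum_uniq | exact: (@uniq_path_edges two_P4) |].
move=> e; rewrite mem_enum; apply/imsetP/idP => [[[x y] /=] xy ->|].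
  case: x y xy => i [] j //; rewrite inE /= /path_adj;
    case: (ord4 i) => ->; case: (ord4 j) => -> //= _;
    rewrite !inE ?eqxx ?orbT //; by rewrite setUC eqxx ?orbT.
rewrite !inE => H; suff [x [y [xy ->]]] : exists x y : two_P4, adj x y /\ e = [set x; y].
  by exists (x, y).
by repeat (case/orP: H => [/eqP->|H]; first by do 2 eexists; split; last reflexivity);
  move/eqP: H => ->; do 2 eexists; split; last reflexivity.
Qed.

Lemma has_rainbow_copyP n (C : eqType) (c : {set complete n} -> C) :
  reflect (exists a b d e a' b' d' e' : 'I_n,
      uniq [:: a; b; d; e; a'; b'; d'; e'] /\
      uniq (map c [:: [set a; b]; [set b; d]; [set d; e];
                      [set a'; b']; [set b'; d']; [set d'; e']]))
    (has_rainbow_copy c two_P4).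
Proof.
have rb (f : two_P4 -> complete n) :
    dinjectiveb (fun e : {set two_P4} => c (f @: e)) (edges two_P4) =
    uniq (map c [:: [set f (inl o0); f (inl o1)]; [set f (inl o1); f (inl o2)];
                    [set f (inl o2); f (inl o3)]; [set f (inr o0); f (inr o1)];
                    [set f (inr o1); f (inr o2)]; [set f (inr o2); f (inr o3)]]).
  rewrite /dinjectiveb (perm_uniq (perm_map _ perm_two_P4_edges)) /=.
  by rewrite !imsetU1 !imset_set1.
apply: (iffP existsP) => [[f /and3P[/injectiveP fi _]]|].
  rewrite rb => uc; exists (f (inl o0)), (f (inl o1)), (f (inl o2)), (f (inl o3)).
  exists (f (inr o0)), (f (inr o1)), (f (inr o2)), (f (inr o3)); split=> //.
  by rewrite -[X in uniq X]/(map f two_P4_vertices) map_inj_uniq.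
case=> [a [b [d [e [a' [b' [d' [e' [us uc]]]]]]]]].
pose f := [ffun v : two_P4 =>
  nth a [:: a; b; d; e; a'; b'; d'; e'] (index v two_P4_vertices)].
have fi : injective f.
  have idx v : v \in two_P4_vertices.
    by case: v => i; case: (ord4 i) => ->.
  have lt8 v : index v two_P4_vertices < 8 by rewrite (index_mem v two_P4_vertices) idx.
  move=> v w; rewrite !ffunE => /eqP; rewrite nth_uniq; [|exact: lt8|exact: lt8|by []].
  by move/eqP => E; rewrite -(nth_index (inl o0) (idx v)) E nth_index.
exists f; apply/and3P; split.
- exact/injectiveP.
- apply/forallP => x; apply/forallP => y; apply/implyP => xy.
  by rewrite /= /complete_adj (inj_eq fi); apply: contraTneq xy => ->; rewrite adj_irrefl.
- by rewrite rb !ffunE.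
Qed.

End TwoP4.

Lemma edges_complete n : edges (complete n) = [set e : {set 'I_n} | #|e| == 2].
Proof.
apply/setP=> e; rewrite inE; apply/imsetP/cards2P => [[[x y] xy ->]|[x [y [xy ->]]]].
  by exists x, y.
by exists (x, y).
Qed.

Lemma num_colorsE (G : sgraph) (C : finType) (c : {set G} -> C) :
  num_colors c = #|c @: edges G|.
Proof.
rewrite /num_colors -(card_uniqP (undup_uniq _)); apply: eq_card => k.
by rewrite mem_undup; apply/mapP/imsetP => -[e eG ->]; exists e; rewrite // mem_enum in eG *.
Qed.

(** * Merging a class of edges into one color *)

Section Merge.

Variables (T : finType) (P : pred T).

(** [None] is the shared color; any other edge is its own color. *)
Definition merge_coloring (e : T) : option T := if P e then None else Some e.

Lemma merge_coloring_None e : (merge_coloring e == None) = P e.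
Proof. by rewrite /merge_coloring; case: ifP. Qed.

Lemma card_merge_coloring (E : {set T}) e0 : e0 \in E -> P e0 ->
  #|[set e in E | ~~ P e]| < #|merge_coloring @: E|.
Proof.
move=> e0E Pe0; rewrite -(card_imset _ (@Some_inj _)).
set B := Some @: _; suff <- : #|None |: B| = #|B|.+1.
  rewrite {}/B.
  apply/subset_leq_card/subsetP => k; rewrite !inE => /predU1P[->|/imsetP[e]].
    by apply/imsetP; exists e0; rewrite // /merge_coloring Pe0.
  rewrite inE => /andP[eE nP] ->; apply/imsetP; exists e => //.
  by rewrite /merge_coloring (negPf nP).
by rewrite cardsU1; case: imsetP => [[]|].
Qed.

Lemma merge_coloring_uniq (s : seq T) : uniq (map merge_coloring s) -> count P s <= 1.
Proof.
move=> u; rewrite -(eq_count (a1 := preim merge_coloring (pred1 None))).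
  by rewrite -count_map count_uniq_mem // leq_b1.
exact: merge_coloring_None.
Qed.

End Merge.

Lemma count_mem_leq (T : finType) (X : {set T}) (s : seq T) :
  uniq s -> count (mem X) s <= #|X|.
Proof.
move=> us; rewrite -size_filter -(card_uniqP (filter_uniq _ us)).
by apply/subset_leq_card/subsetP => x; rewrite mem_filter => /andP[].
Qed.

(** A rainbow copy has at most one merged edge. The strict inequality counts the shared color, which
    [e0] shows to be used. *)
Lemma leq_ar_merge n (P : pred {set 'I_n}) (e0 : {set 'I_n}) :
  #|e0| = 2 -> P e0 ->
  (forall a b d e a' b' d' e' : 'I_n, uniq [:: a; b; d; e; a'; b'; d'; e'] ->
     1 < count P [:: [set a; b]; [set b; d]; [set d; e];
                     [set a'; b']; [set b'; d']; [set d'; e']]) ->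
  #|[set e : {set 'I_n} | (#|e| == 2) && ~~ P e]| < ar (complete n) two_P4.
Proof.
move=> e02 Pe0 H; pose c := @merge_coloring {set complete n} P.
have nc : ~~ has_rainbow_copy c two_P4.
  apply/negP => /has_rainbow_copyP[a [b [d [e [a' [b' [d' [e' [us uc]]]]]]]]].
  by have := merge_coloring_uniq uc; rewrite leqNgt H.
apply: leq_trans (leq_ar nc); rewrite num_colorsE edges_complete.
apply: leq_ltn_trans (card_merge_coloring (e0 := e0) _ Pe0); last by rewrite inE e02.
by apply/subset_leq_card/subsetP => e; rewrite !inE.
Qed.

Lemma card_ord_lt n k : k <= n -> #|[set i : 'I_n | i < k]| = k.
Proof.
move=> kn; have wi : injective (widen_ord kn).
  by move=> i j /(congr1 val) /= ij; apply: val_inj.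
rewrite -[RHS]card_ord -cardsT -(card_imset _ wi).
apply: eq_card => i; rewrite inE; apply/idP/imsetP => [ik|[j _ ->]]; last exact: (ltn_ord j).
by exists (Ordinal ik); rewrite ?inE //; apply: val_inj.
Qed.

(** A vertex lies on at most two edges of a 2P4, so two vertices meet at most four of its six
    edges. *)
Lemma leq_ar_star n : 8 <= n -> 2 * n - 2 <= ar (complete n) two_P4.
Proof.
move=> n8; pose X : {set 'I_n} := [set i : 'I_n | i < 2].
have X2 : #|X| = 2 by apply: card_ord_lt; lia.
have XC : #|~: X| = n - 2 by rewrite -[n in RHS]card_ord -(cardsC X) X2 addKn.
have : 0 < #|[set e : {set 'I_n} | (e \subset ~: X) && (#|e| == 2)]|.
  by rewrite cards_draws XC bin_gt0; lia.
case/card_gt0P=> e0; rewrite inE => /andP[e0X /eqP e02].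
apply: leq_trans (leq_ar_merge (P := fun e => e \subset ~: X) e02 e0X _); last first.
  move=> a b d e a' b' d' e' /(count_mem_leq X); rewrite X2 /= !subUset !sub1set !inE.
  by do 8! case: (_ < 2).
rewrite (_ : [set e | _] = [set e : {set 'I_n} | (e \subset [set: 'I_n]) && (#|e| == 2)]
   :\: [set e : {set 'I_n} | (e \subset ~: X) && (#|e| == 2)]); last first.
  by apply/setP=> e; rewrite !inE subsetT; case: (#|e| == 2); rewrite ?andbF ?andbT.
rewrite cardsDS; last by apply/subsetP=> e; rewrite !inE subsetT => /andP[].
rewrite !cards_draws XC cardsT card_ord.
(* The number of edges meeting [X] is the difference of two binomials, [2n - 3] for the original
   [n]; the shared color adds one. *)
case: n n8 {X X2 XC e0 e0X e02} => [|[|n]] // n8.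
rewrite (_ : n.+2 - 2 = n) ?subn2 // !binS !bin1 !bin0; lia.
Qed.

(** At least two of the eight vertices of a 2P4 lie outside [X]. They meet at least two of its
    edges, because no component is a single edge. The colors are the 15 edges inside [X] and the
    shared one. *)
Lemma leq_ar_clique n : 8 <= n -> 16 <= ar (complete n) two_P4.
Proof.
move=> n8; pose X : {set 'I_n} := [set i : 'I_n | i < 6].
have X6 : #|X| = 6 by apply: card_ord_lt; lia.
have XC : #|~: X| = n - 6 by rewrite -[n in RHS]card_ord -(cardsC X) X6 addKn.
have : 0 < #|[set e : {set 'I_n} | (e \subset ~: X) && (#|e| == 2)]|.
  by rewrite cards_draws XC bin_gt0; lia.
case/card_gt0P=> e0; rewrite inE => /andP[e0X /eqP e02].
have nX : ~~ (e0 \subset X).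
  apply/negP => e0X'; have : e0 \subset set0 by rewrite -(setICr X) subsetI e0X' e0X.
  by rewrite subset0 => /eqP e00; rewrite e00 cards0 in e02.
apply: leq_trans (leq_ar_merge (P := fun e => ~~ (e \subset X)) e02 nX _); last first.
  move=> a b d e a' b' d' e' /(count_mem_leq X); rewrite X6 /= !subUset !sub1set !inE.
  (* All ways of placing the eight vertices inside or outside [X] are checked. *)
  by do 8! case: (_ < 6).
rewrite (_ : [set e | _] = [set e : {set 'I_n} | (e \subset X) && (#|e| == 2)]); last first.
  by apply/setP=> e; rewrite !inE negbK andbC.
by rewrite cards_draws X6.
Qed.

Theorem theorem10 (n : nat) (hn : 8 <= n) :
  ar (complete n) (disjoint_union (path_graph 4) (path_graph 4))
    = maxn (2 * n - 2) 16.
Proof.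
apply/eqP; rewrite eqn_leq geq_max leq_ar_star // leq_ar_clique // !andbT.
apply/bigmax_leqP => c nc; have nr : no_rainbow c.
  move=> a b d e a' b' d' e' us; apply: contra nc => uc.
  by apply/has_rainbow_copyP; exists a, b, d, e, a', b', d', e'.
have := leq_card_palette_max nr (S := [set: 'I_n]); rewrite cardsT card_ord => /(_ hn).
apply: leq_trans; rewrite num_colorsE.
apply/subset_leq_card/imsetS/subsetP => e; rewrite (edges_complete n) !inE.
by rewrite subsetT.
Qed.
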